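(* Let $f:\mathbb{R}^n\to\mathbb{R}$ and let $\{\mathbf{x}_t\}_{t\in\mathbb{N}}$ be the sequence generated by the SZGD algorithm applied to $f$, such that the standing assumptions (i)–(v) listed in the context hold; in particular $f$ is $L$-smooth and is a differentiable Łojasiewicz function with exponent $\theta\in(0,1)$. Let $\mathbf{x}_\infty$ be the almost sure limit of $\{\mathbf{x}_t\}_t$. Suppose the step sizes $\eta_t$ are such that there exist $\eta_-,\eta_+\in(0,\infty)$ with $\eta_-\le\eta_t\le\eta_+$ for all $t$. Then: (a) if $\theta\in(0,\frac12]$, $-1\le \frac{Ln\eta_-^2}{2k}-\eta_-<0$ and $-1\le\frac{Ln\eta_+^2}{2k}-\eta_+<0$, there exists a constant $Q>1$ such that $\left\{Q^t\sum_{s=t}^\infty\|\mathbf{x}_{s+1}-\mathbf{x}_s\|^2\right\}_t$ converges to $0$ in expectation, i.e. $\lim_{t\to\infty}\mathbb{E}\left[Q^t\sum_{s=t}^\infty\|\mathbf{x}_{s+1}-\mathbf{x}_s\|^2\right]=0$; (b) if $\theta\in(\frac12,1)$ and $\eta_-,\eta_+\in\left(0,\frac{2k}{Ln}\right)$, then $\left\{\sum_{s=t}^\infty\|\mathbf{x}_{s+1}-\mathbf{x}_s\|^2\right\}_t$ converges to $0$ at rate $O\left(t^{\frac{1}{1-2\theta}}\right)$ in expectation, i.e. $\mathbb{E}\left[\sum_{s=t}^\infty\|\mathbf{x}_{s+1}-\mathbf{x}_s\|^2\right]=O\left(t^{\frac{1}{1-2\theta}}\right)$ as $t\to\infty$.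
   Context: $\|\cdot\|$ is the Euclidean norm. A critical point of a differentiable $f$ is a point where $\nabla f$ vanishes. $L$-smooth: $f:\mathbb{R}^n\to\mathbb{R}$ is $L$-smooth if it is continuously differentiable and $\|\nabla f(\mathbf{x})-\nabla f(\mathbf{x}')\|\le L\|\mathbf{x}-\mathbf{x}'\|$ for all $\mathbf{x},\mathbf{x}'\in\mathbb{R}^n$. Łojasiewicz function: a differentiable $f$ is a (differentiable) Łojasiewicz function with Łojasiewicz exponent $\theta\in(0,1)$ if for any $\mathbf{x}^*$ with $\nabla f(\mathbf{x}^* )=0$ there exist constants $\kappa,\mu>0$ such that $|f(\mathbf{x})-f(\mathbf{x}^* )|^\theta\le\kappa\|\nabla f(\mathbf{x})\|$ for all $\mathbf{x}$ with $\|\mathbf{x}-\mathbf{x}^*\|\le\mu$. SZGD (Stochastic Zeroth-order Gradient Descent): fix integers $1\le k\le n$, an initial point $\mathbf{x}_0\in\mathbb{R}^n$, $\delta_0=1$ (or $\delta_0\in(0,1)$), and step sizes $\eta_t>0$. Let $\mathrm{St}(n,k)=\{\mathbf{X}\in\mathbb{R}^{n\times k}:\mathbf{X}^\top\mathbf{X}=\mathbf{I}_k\}$. For $t=0,1,2,\dots$: sample (independently of the past) $\mathbf{V}_t=[\mathbf{v}_{t,1},\dots,\mathbf{v}_{t,k}]$ uniformly from $\mathrm{St}(n,k)$, set $$\widehat{\nabla}f_{\mathbf{V}_t}^{\delta_t}(\mathbf{x}_t)=\frac{n}{2\delta_t k}\sum_{i=1}^k\left(f(\mathbf{x}_t+\delta_t\mathbf{v}_{t,i})-f(\mathbf{x}_t-\delta_t\mathbf{v}_{t,i})\right)\mathbf{v}_{t,i},$$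 $\mathbf{x}_{t+1}=\mathbf{x}_t-\eta_t\widehat{\nabla}f_{\mathbf{V}_t}^{\delta_t}(\mathbf{x}_t)$, and $\delta_{t+1}=\delta_t/2$. Standing assumptions: (i) $f$ is $L$-smooth for some constant $L>0$; (ii) $f$ is a differentiable Łojasiewicz function with exponent $\theta$; (iii) $\inf_{\mathbf{x}\in\mathbb{R}^n}f(\mathbf{x})>-\infty$; (iv) all critical points of $f$ are isolated; (v) there exists a critical point $\mathbf{x}^*$ of $f$ such that the SZGD sequence satisfies $\|\mathbf{x}_t-\mathbf{x}^*\|\le\mu$ for all $t$, where $\mu$ is the radius in the Łojasiewicz inequality at $\mathbf{x}^*$. *)

(* Defs.v *)
From HB Require Import structures.
From mathcomp Require Import all_boot all_order all_algebra finmap.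
From mathcomp Require Import all_classical all_reals all_analysis.

Set Implicit Arguments.
Unset Strict Implicit.
Unset Printing Implicit Defensive.

Import Order.TTheory GRing.Theory Num.Theory.
Import numFieldNormedType.Exports.

Local Open Scope classical_set_scope.
Local Open Scope ring_scope.

(* Points of R^n are column vectors. The norm `|x|
   that the library puts on matrices is the sup norm; it induces the same
   topology and the same notion of differentiability as the Euclidean norm,
   but metric statements below must use [enorm]. *)
Definition enorm (R : realType) (n : nat) (x : 'cV[R]_n) : R :=
  Num.sqrt (\sum_(i < n) x i 0 ^+ 2).

(* Meaningful where f is differentiable, which all hypotheses on f below
   require. *)
Definition grad (R : realType) (n : nat) (f : 'cV[R]_n -> R) (x : 'cV[R]_n) :
    'cV[R]_n :=
  \col_(i < n) 'D_(delta_mx i 0) f x.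

Definition critical (R : realType) (n : nat) (f : 'cV[R]_n -> R) :
    set 'cV[R]_n :=
  [set x | grad f x = 0].

Definition lsmooth (R : realType) (n : nat) (L : R) (f : 'cV[R]_n -> R) : Prop :=
  [/\ forall x, differentiable f x,
      continuous (grad f) &
      forall x y, enorm (grad f x - grad f y) <= L * enorm (x - y)].

Definition lojasiewicz_at (R : realType) (n : nat) (f : 'cV[R]_n -> R)
    (theta : R) (xs : 'cV[R]_n) (kappa mu : R) : Prop :=
  forall x, enorm (x - xs) <= mu ->
    `|f x - f xs| `^ theta <= kappa * enorm (grad f x).

Definition lojasiewicz (R : realType) (n : nat) (f : 'cV[R]_n -> R)
    (theta : R) : Prop :=
  [/\ 0 < theta < 1,
      forall x, differentiable f x &
      forall xs, critical f xs ->
        exists kappa mu : R,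
          [/\ 0 < kappa, 0 < mu & lojasiewicz_at f theta xs kappa mu]].

Definition stiefel (R : realType) (n k : nat) : set 'M[R]_(n, k) :=
  [set X | X^T *m X = 1%:M].

Definition borel_mx (R : realType) (n k : nat) : set (set 'M[R]_(n, k)) :=
  <<s open >>.

(* The uniform distribution on St(n,k) is the (unique) probability measure
   carried by St(n,k) that is invariant under the transitive action of the
   orthogonal group O(n) by left multiplication. *)
Definition uniform_stiefel (R : realType) (n k : nat) (d : measure_display)
    (Omega : measurableType d) (P : probability Omega R)
    (V : Omega -> 'M[R]_(n, k)) : Prop :=
  [/\ forall A, borel_mx A -> measurable (V @^-1` A),
      {ae P, forall w, stiefel (V w)} &
      forall U : 'M[R]_n, U^T *m U = 1%:M -> forall A, borel_mx A ->
        P ((fun w => U *m V w) @^-1` A) = P (V @^-1` A)].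

Definition mutually_independent (R : realType) (n k : nat)
    (d : measure_display) (Omega : measurableType d) (P : probability Omega R)
    (V : nat -> Omega -> 'M[R]_(n, k)) : Prop :=
  forall (J : {fset nat}) (A : nat -> set 'M[R]_(n, k)),
    (forall j, borel_mx (A j)) ->
    P (\bigcap_(j in [set` J]) (V j @^-1` A j)) =
      (\prod_(j <- J) P (V j @^-1` A j))%E.

Definition zo_grad (R : realType) (n k : nat) (f : 'cV[R]_n -> R)
    (V : 'M[R]_(n, k)) (delta : R) (x : 'cV[R]_n) : 'cV[R]_n :=
  (n%:R / (2 * delta * k%:R)) *:
    \sum_(i < k) (f (x + delta *: col i V) - f (x - delta *: col i V))
                   *: col i V.

Fixpoint szgd_delta (R : realType) (delta0 : R) (t : nat) : R :=
  if t is s.+1 then szgd_delta delta0 s / 2 else delta0.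

(* The iterate x_t along one realization (V_t)_t of the random frames. *)
Fixpoint szgd (R : realType) (n k : nat) (f : 'cV[R]_n -> R)
    (eta : nat -> R) (delta0 : R) (x0 : 'cV[R]_n)
    (V : nat -> 'M[R]_(n, k)) (t : nat) : 'cV[R]_n :=
  if t is s.+1 then
    let x := szgd f eta delta0 x0 V s in
    x - eta s *: zo_grad f (V s) (szgd_delta delta0 s) x
  else x0.

(* Extended-real valued: the series may a priori diverge to +oo. *)
Definition tail_energy (R : realType) (n : nat) (x : nat -> 'cV[R]_n)
    (t : nat) : \bar R :=
  (\sum_(t <= s <oo) (enorm (x s.+1 - x s) ^+ 2)%:E)%E.

(* Main.v *)
Require Import Defs.
From HB Require Import structures.
From mathcomp Require Import all_boot all_order all_algebra finmap.
From mathcomp Require Import fingroup perm.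
From mathcomp Require Import all_classical all_reals all_analysis.
From mathcomp Require Import measurable_realfun ring lra.

Set Implicit Arguments.
Unset Strict Implicit.
Unset Printing Implicit Defensive.

Import Order.TTheory GRing.Theory Num.Theory.
Import numFieldNormedType.Exports.

Local Open Scope classical_set_scope.
Local Open Scope ring_scope.

(** Along one step the gradient estimate sees the true gradient only through
the frame: with G_t = V_t^T grad f(x_t), a central difference in a direction v
of the frame is <grad f(x_t), v> up to L delta_t / 2. Inserting this in the
quadratic upper bound for L-smooth functions, and using that V_t has
orthonormal columns, gives almost surely
  f(x_{t+1}) <= f(x_t) - c |G_t|^2 + C delta_t^2,
  |x_{t+1} - x_t|^2 <= C (|G_t|^2 + delta_t^2)
(szgd_one_step), where c > 0 because the step sizes are bounded away
from 0 and from 2k / (Ln); both sets of step-size conditions give the latter.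

Taking expectations needs E |G_t|^2 = (k/n) E |grad f(x_t)|^2
(Rintegral_proj_energy). The iterate x_t is measurable with respect to the
frames V_0, ..., V_{t-1}, hence independent of V_t, and E[V_t V_t^T] = (k/n) I:
reflecting one coordinate kills the off-diagonal moments, exchanging two
coordinates makes the diagonal ones equal, and the trace of V V^T is k.

Let a_t = E[f(x_t) - f(xs)] and p = max(1, 2 theta). The Lojasiewicz inequality
in the ball around xs, together with Jensen's inequality, gives
|a_t|^p <= K E |G_t|^2; when 2 theta < 1 the exponent is raised to 1 by
boundedness of f - f(xs) on the ball. Adding a multiple of delta_t^2 to a_t
absorbs the discretisation error, which decays geometrically, and produces a
Lyapunov sequence b with
  b_{t+1} <= b_t - c1 (E |G_t|^2 + delta_t^2),   b_{t+1} <= b_t - c2 b_t^p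
(lyapunov_recursion). It is nonnegative: below a negative value the
Lojasiewicz bound would force a decrease at linear speed for ever. Together
with the second inequality this makes E f(x_t) converge to f(xs).

The first inequality telescopes and bounds the expected tail energy by a
multiple of b_t (szgd_lyapunov). The second one decides the rate: geometric for
p = 1, and t^(1/(1-p)) for p > 1 because b_t^(1-p) then grows linearly. *)

(** * Power inequalities and decay of real recursions *)

(** Bernoulli's inequality for a real exponent, read off Young's inequality
between u and 1 with conjugate exponents p and (1 - 1/p)^-1. *)
Lemma powR_ge_tangent (R : realType) (p u : R) : 1 <= p -> 0 <= u ->
  1 + p * (u - 1) <= u `^ p.
Proof.
rewrite le_eqVlt => /predU1P[<- u0|p1 u0]; first by rewrite powRr1//; lra.
have p0 : 0 < p by lra.
have q0 : 0 < 1 - p^-1 by rewrite subr_gt0 invf_lt1.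
have := @conjugate_powR R u 1 p (1 - p^-1)^-1 u0 ler01 p0.
rewrite invr_gt0 invrK => /(_ q0); rewrite [p^-1 + _]addrC subrK => /(_ erefl).
rewrite powR1 mulr1 mul1r -(ler_pM2l p0) mulrDr mulrBr divff ?gt_eqF//.
by rewrite (mulrC (_ `^ _)) mulVKf ?gt_eqF//; lra.
Qed.

(** The convex function x^(-s) lies above its tangents. After division by
x^(-s) this is exp(- s ln u) >= 1 - s ln u together with ln u <= u - 1. *)
Lemma powR_opp_ge_tangent (R : realType) (s x y : R) :
  0 < s -> 0 < x -> 0 < y ->
  x `^ (- s) + s * x `^ (- s - 1) * (x - y) <= y `^ (- s).
Proof.
move=> s0 x0 y0.
have yx0 : 0 < y / x by rewrite divr_gt0.
have -> : y `^ (- s) = x `^ (- s) * (y / x) `^ (- s).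
  by rewrite -powRM ?ltW// mulrC divfK ?gt_eqF.
have -> : x `^ (- s) + s * x `^ (- s - 1) * (x - y) =
    x `^ (- s) * (1 - s * (y / x - 1)).
  rewrite powRD; last by rewrite (gt_eqF x0) implybT.
  by rewrite powR_inv1 ?ltW//; field; rewrite gt_eqF.
rewrite ler_wpM2l ?powR_ge0// /powR gt_eqF//.
apply: le_trans (expR_ge1Dx _); rewrite mulNr lerD2l lerN2 ler_pM2l//.
have := @expR_ge1Dx R (ln (y / x)); rewrite lnK ?posrE//; lra.
Qed.

Lemma linear_recursion_decay (R : realType) (b : nat -> R) (c : R) :
  c <= 1 -> (forall t, b t.+1 <= b t - c * b t) ->
  forall t, b t <= (1 - c) ^+ t * b 0%N.
Proof.
move=> c1 bS; elim=> [|t IH]; first by rewrite expr0 mul1r.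
apply: (le_trans (bS t)); rewrite exprS -mulrA.
have -> : b t - c * b t = (1 - c) * b t by ring.
by rewrite ler_wpM2l// subr_ge0.
Qed.

(** The tangent inequality turns the recursion into
b_{t+1}^(1-p) >= b_t^(1-p) + (p-1) c, so that b_t^(1-p) >= (p-1) c t. It needs
positive values, which the values preceding a positive one have by
monotonicity. *)
Lemma superlinear_recursion_decay (R : realType) (b : nat -> R) (c p : R) :
  0 < c -> 1 < p -> (forall t, 0 <= b t) ->
  (forall t, b t.+1 <= b t - c * b t `^ p) ->
  forall t, (0 < t)%N ->
  b t <= ((p - 1) * c) `^ (1 / (1 - p)) * t%:R `^ (1 / (1 - p)).
Proof.
move=> c0 p1 b0 bS t t0.
have s0 : 0 < p - 1 by rewrite subr_gt0.
have sc0 : 0 < (p - 1) * c by rewrite mulr_gt0.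
have t0R : 0 < t%:R :> R by rewrite ltr0n.
have [->|bt] := eqVneq (b t) 0; first by rewrite mulr_ge0 ?powR_ge0.
have {}bt : 0 < b t by rewrite lt_neqAle eq_sym bt b0.
have bpos : forall s, (s <= t)%N -> 0 < b s.
  move=> s; rewrite -(subnKC t0); move=> st.
  have : forall m, 0 < b (s + m)%N -> 0 < b s.
    elim=> [|m IH]; first by rewrite addn0.
    rewrite addnS => bm; apply: IH; apply: lt_le_trans bm _.
    by apply: (le_trans (bS _)); rewrite gerBl mulr_ge0 ?powR_ge0// ltW.
  by move/(_ (t - s)%N); apply; rewrite subnKC// -(subnKC t0).
have key : forall s, (s <= t)%N -> (p - 1) * c * s%:R <= b s `^ (- (p - 1)).
  elim=> [|s IH] st; first by rewrite mulr0 powR_ge0.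
  have bs := bpos _ (ltnW st); have bs1 := bpos _ st.
  apply: le_trans (powR_opp_ge_tangent s0 bs bs1).
  rewrite -natr1 mulrDr mulr1; apply: lerD; first exact: IH (ltnW st).
  have := bS s; rewrite lerBrDr addrC -lerBrDr => h.
  have -> : - (p - 1) - 1 = - p by ring.
  apply: (@le_trans _ _ ((p - 1) * b s `^ (- p) * (c * b s `^ p))).
    have bp0 : b s `^ p != 0 by rewrite gt_eqF// powR_gt0.
    rewrite powRN (_ : _ * (c * _) = (p - 1) * c)//.
    by field.
  by rewrite ler_wpM2l// mulr_ge0 ?powR_ge0// ltW.
have e0 : 0 < (p - 1)^-1 by rewrite invr_gt0.
have -> : 1 / (1 - p) = - (p - 1)^-1 by field; lra.
rewrite -powRM ?ler0n ?(ltW sc0)//.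
have {1}-> : b t = (b t `^ (- (p - 1))) `^ (- (p - 1)^-1).
  rewrite -powRrM (_ : _ * _ = 1) ?powRr1 ?ltW//.
  by field; lra.
rewrite [leLHS]powRN [leRHS]powRN.
rewrite lef_pV2 ?posrE ?powR_gt0 ?mulr_gt0//.
by rewrite ge0_ler_powR ?nnegrE ?powR_ge0 ?key// ?ltW ?mulr_gt0.
Qed.

(** * The Euclidean inner product and smooth functions *)

Definition dot (R : realType) (n : nat) (u v : 'cV[R]_n) : R :=
  \sum_(i < n) u i 0 * v i 0.

Section dot_product.
Variables (R : realType) (n : nat).
Implicit Types u v w : 'cV[R]_n.

Lemma dotC u v : dot u v = dot v u.
Proof. by apply: eq_bigr => i _; rewrite mulrC. Qed.

Lemma dotDl u v w : dot (u + v) w = dot u w + dot v w.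
Proof. by rewrite -big_split; apply: eq_bigr => i _; rewrite mxE mulrDl. Qed.

Lemma dotZl a u v : dot (a *: u) v = a * dot u v.
Proof. by rewrite mulr_sumr; apply: eq_bigr => i _; rewrite mxE mulrA. Qed.

Lemma dotNl u v : dot (- u) v = - dot u v.
Proof. by rewrite -scaleN1r dotZl mulN1r. Qed.

Lemma dotDr u v w : dot w (u + v) = dot w u + dot w v.
Proof. by rewrite !(dotC w) dotDl. Qed.

Lemma dotZr a u v : dot u (a *: v) = a * dot u v.
Proof. by rewrite !(dotC u) dotZl. Qed.

Lemma dotNr u v : dot u (- v) = - dot u v.
Proof. by rewrite !(dotC u) dotNl. Qed.

Lemma dot0l v : dot 0 v = 0.
Proof. by rewrite /dot big1// => i _; rewrite mxE mul0r. Qed.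

Lemma dot_sumr (I : finType) (F : I -> 'cV[R]_n) u :
  dot u (\sum_i F i) = \sum_i dot u (F i).
Proof.
apply: (big_morph (dot u) (fun v w => dotDr v w u)).
by rewrite dotC dot0l.
Qed.

Lemma dot_ge0 u : 0 <= dot u u.
Proof. by apply: sumr_ge0 => i _; rewrite -expr2 sqr_ge0. Qed.

Lemma enorm_sqr u : enorm u ^+ 2 = dot u u.
Proof.
rewrite sqr_sqrtr; last by apply: sumr_ge0 => i _; rewrite sqr_ge0.
by apply: eq_bigr => i _; rewrite expr2.
Qed.

Lemma enorm_ge0 u : 0 <= enorm u.
Proof. exact: sqrtr_ge0. Qed.

Lemma sqr_coord_le u i : u i 0 ^+ 2 <= dot u u.
Proof.
rewrite /dot (bigD1 i)//= -expr2 lerDl; apply: sumr_ge0 => j _.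
by rewrite -expr2 sqr_ge0.
Qed.

(** Cauchy-Schwarz in the form needed for Lipschitz gradients, where the
norm of u is only known to be at most a times that of v; both signs come from
expanding the squared norms of u + a v and u - a v. *)
Lemma dot_le_scale (a : R) u v : 0 < a -> dot u u <= a ^+ 2 * dot v v ->
  `|dot u v| <= a * dot v v.
Proof.
move=> a0 uv; have := dot_ge0 (u + a *: v); have := dot_ge0 (u - a *: v).
rewrite -scaleNr !(dotDl, dotDr, dotZl, dotZr) (dotC v u) => h1 h2.
rewrite -(ler_pM2l a0) -(gtr0_norm a0) -normrM (gtr0_norm a0) ler_norml.
by apply/andP; split; lra.
Qed.

End dot_product.

Section gradient.
Variables (R : realType) (n : nat) (f : 'cV[R]_n -> R).

(** A derivative is linear in its direction, and the gradient lists its values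
on the coordinate directions. *)
Lemma derive_dot_grad x h : differentiable f x -> 'D_h f x = dot (grad f x) h.
Proof.
move=> df; rewrite deriveE//.
rewrite {1}[h]matrix_sum_delta linear_sum /dot; apply: eq_bigr => i _.
by rewrite big_ord1 linearZ mxE deriveE// mulrC.
Qed.

Lemma is_derive_segment x h (s : R) : differentiable f (x + s *: h) ->
  is_derive s 1 (fun s => f (x + s *: h)) (dot (grad f (x + s *: h)) h).
Proof.
move=> df; rewrite -derive_dot_grad//.
have E : (fun u : R =>
      u^-1 *: ((f \o shift (x + s *: h)) (u *: h) - f (x + s *: h))) =
    (fun u : R => u^-1 *: (((fun s => f (x + s *: h)) \o shift s) (u *: 1)
       - f (x + s *: h))).
  apply/funext => u /=; congr (_ *: (f _ - _)).
  by rewrite [u *: 1]mulr1 scalerDl [LHS]addrCA.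
apply: DeriveDef; last by rewrite /derive E.
by rewrite /derivable -E; apply: diff_derivable.
Qed.

Variable L : R.
Hypotheses (L0 : 0 < L) (f_smooth : lsmooth L f).

Let df x : differentiable f x. Proof. by case: f_smooth. Qed.

Lemma lsmooth_dot x y :
  dot (grad f x - grad f y) (grad f x - grad f y)
    <= L ^+ 2 * dot (x - y) (x - y).
Proof.
rewrite -!enorm_sqr -exprMn; case: f_smooth => _ _ /(_ x y) h.
by rewrite ler_sqr ?nnegrE ?mulr_ge0 ?enorm_ge0// ltW.
Qed.

(** The mean value theorem for the segment from x to x + h, applied to the
defect of the inequality as a function psi of the position on the segment: the
Lipschitz bound on the gradient makes psi' nonpositive. The sign e produces
the two one-sided bounds at once. *)
Lemma smooth_descent_signed (e : R) x h : `|e| = 1 ->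
  e * (f (x + h) - f x - dot (grad f x) h) <= L / 2 * dot h h.
Proof.
move=> e1.
pose psi := fun s : R => e * (f (x + s *: h) - s * dot (grad f x) h)
  - L / 2 * dot h h * s ^+ 2.
pose dpsi := fun s : R => e * (dot (grad f (x + s *: h)) h - dot (grad f x) h)
  - L * dot h h * s.
have psiD (s : R) : is_derive s 1 psi (dpsi s).
  have fD := @is_derive_segment x h s (df _).
  rewrite /psi /dpsi.
  have -> : (fun s0 : R => e * (f (x + s0 *: h) - s0 * dot (grad f x) h) -
      L / 2 * dot h h * s0 ^+ 2) =
    e \*: ((fun s0 => f (x + s0 *: h)) - dot (grad f x) h \*: id) -
    (L / 2 * dot h h) \*: (id ^+ 2).
    apply/funext => u; rewrite !fctE /=.
    by rewrite (mulrC u).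
  apply: is_derive_eq; rewrite /GRing.scale /= !expr1.
  by field.
have cpsi : {within `[0, 1], continuous psi}.
  apply: continuous_subspaceT => s; apply: differentiable_continuous.
  by apply/derivable1_diffP; case: (psiD s).
have [c + E] := MVT ltr01 (fun s _ => psiD s) cpsi.
rewrite in_itv/= => /andP[c0 c1].
have : dpsi c <= 0.
  rewrite /dpsi subr_le0 -dotNl -dotDl.
  apply: (le_trans (ler_norm _)); rewrite normrM e1 mul1r [leRHS]mulrAC.
  (* Cauchy-Schwarz at distance c |h| from x, where the gradient has moved by
     at most L c |h| *)
  apply: dot_le_scale; first exact: mulr_gt0.
  apply: (le_trans (lsmooth_dot _ _)).
  rewrite [x + _]addrC addrK dotZl dotZr; lra.
move: E; rewrite subr0 mulr1 => <-.
rewrite /psi scale1r scale0r addr0 mul0r expr0n/= mulr0 expr1n; lra.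
Qed.

Lemma smooth_descent x h :
  `|f (x + h) - f x - dot (grad f x) h| <= L / 2 * dot h h.
Proof.
have h1 := @smooth_descent_signed 1 x h (normr1 _).
have h2 := @smooth_descent_signed (-1) x h (normrN1 _).
by rewrite ler_norml; apply/andP; split; lra.
Qed.

(** Opposite increments cancel the value of f at x, so the two quadratic errors
of size L delta^2 / 2 are all that remains. *)
Lemma central_difference_error x (v : 'cV[R]_n) (delta : R) : 0 < delta ->
  dot v v = 1 ->
  `|(f (x + delta *: v) - f (x - delta *: v)) / (2 * delta) - dot (grad f x) v|
    <= L * delta / 2.
Proof.
move=> d0 v1.
have := smooth_descent x (delta *: v); have := smooth_descent x (- (delta *: v)).
rewrite !(dotNl, dotNr, dotZl, dotZr) v1 !ler_norml.
move=> /andP[h1 h2] /andP[h3 h4].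
set fp := f (x + _) in h3 h4 *; set fm := f (x - _) in h1 h2 *.
set g := dot (grad f x) v in h1 h2 h3 h4 *.
have -> : (fp - fm) / (2 * delta) - g = (fp - fm - 2 * delta * g) / (2 * delta).
  by field; rewrite gt_eqF.
have dd : 0 < 2 * delta by rewrite mulr_gt0.
by rewrite ler_pdivlMr// ler_pdivrMr//; apply/andP; split; lra.
Qed.

End gradient.

(** * One step of the iteration along a fixed frame *)

(** The squared norm of V^T u, the part of u seen by the frame V. *)
Definition proj_energy (R : realType) (n k : nat) (V : 'M[R]_(n, k))
    (u : 'cV[R]_n) : R :=
  \sum_(i < k) dot u (col i V) ^+ 2.

(** The contribution of one direction of the frame, with G the directional
derivative, e the finite-difference error and b = L alpha / 2 for the scaled
step alpha. The cross term (2b - 1) G e is split by Young's inequality,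
which costs half of the margin g since |2b - 1| <= 1. *)
Lemma young_descent_term (R : realFieldType) (b g G e : R) :
  0 < g -> 0 <= b -> g <= 1 - b ->
  - (G + e) * G + b * (G + e) ^+ 2
    <= - (g / 2 * G ^+ 2) + ((2 * g)^-1 + 1) * e ^+ 2.
Proof.
move=> g0 b0 gb.
(* after the substitution e = g u the difference of the two sides is
   h1 / 2 + 2 h2 + h3 + h4, where 1 - (2b - 1)^2 = 4 b (1 - b) gives h2 *)
have [u ->] : exists u, e = g * u by exists (e / g); field; rewrite gt_eqF.
have -> : ((2 * g)^-1 + 1) * (g * u) ^+ 2 = g / 2 * u ^+ 2 + (g * u) ^+ 2.
  by field; rewrite gt_eqF.
have h1 : 0 <= g * (G - (2 * b - 1) * u) ^+ 2.
  by rewrite mulr_ge0 ?sqr_ge0// ltW.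
have h2 : 0 <= g * (b * (1 - b) * u ^+ 2).
  apply: mulr_ge0; first exact: ltW.
  by apply: mulr_ge0; [apply: mulr_ge0; lra|exact: sqr_ge0].
have h3 : 0 <= (1 - b - g) * G ^+ 2 by rewrite mulr_ge0 ?sqr_ge0//; lra.
have h4 : 0 <= (1 - b) * (g * u) ^+ 2 by rewrite mulr_ge0 ?sqr_ge0//; lra.
lra.
Qed.

Section fixed_frame.
Variables (R : realType) (n k : nat).
Hypotheses (k_gt0 : (0 < k)%N) (le_kn : (k <= n)%N).
Implicit Types (V : 'M[R]_(n, k)) (x u : 'cV[R]_n).

Lemma proj_energy_ge0 V u : 0 <= proj_energy V u.
Proof. by apply: sumr_ge0 => i _; exact: sqr_ge0. Qed.

Lemma stiefel_dot V i j : stiefel V -> dot (col i V) (col j V) = (i == j)%:R.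
Proof.
move=> /matrixP /(_ i j); rewrite !mxE => <-.
by apply: eq_bigr => l _; rewrite !mxE.
Qed.

Lemma stiefel_dot_sum V (a : 'I_k -> R) : stiefel V ->
  dot (\sum_i a i *: col i V) (\sum_i a i *: col i V) = \sum_i a i ^+ 2.
Proof.
move=> SV; rewrite dot_sumr; apply: eq_bigr => i _.
rewrite dotC dot_sumr (bigD1 i)//= !dotZl dotZr stiefel_dot// eqxx mulr1 -expr2.
rewrite big1 ?addr0// => j ji.
by rewrite dotZl dotZr stiefel_dot// eq_sym (negbTE ji) !mulr0.
Qed.

Variables (f : 'cV[R]_n -> R) (L : R).
Hypotheses (L0 : 0 < L) (f_smooth : lsmooth L f).

(** The constants depend on the step sizes only through the two bounds etam and
etap; the margin g = 1 - L n etap / (2k) left by the quadratic term of the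
descent inequality is positive by the bound on etap. *)
Lemma szgd_one_step (etam etap : R) :
  0 < etam -> etap < 2 * k%:R / (L * n%:R) ->
  exists c C : R, [/\ 0 < c, 0 < C &
    forall V x (eta delta : R), stiefel V -> etam <= eta <= etap -> 0 < delta ->
    let y := x - eta *: zo_grad f V delta x in
    f y <= f x - c * proj_energy V (grad f x) + C * delta ^+ 2 /\
    enorm (y - x) ^+ 2 <= C * (proj_energy V (grad f x) + delta ^+ 2)].
Proof.
move=> em0 epL.
have k0 : 0 < k%:R :> R by rewrite ltr0n.
have n0 : 0 < n%:R :> R by rewrite ltr0n (leq_trans k_gt0).
have Ln0 : 0 < L * n%:R by rewrite mulr_gt0.
pose r : R := n%:R / k%:R.
have r0 : 0 < r by rewrite divr_gt0.
pose g := 1 - L * etap * r / 2.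
have g0 : 0 < g.
  move: epL; rewrite ltr_pdivlMr// => epL; rewrite subr_gt0.
  have -> : L * etap * r / 2 = (etap * (L * n%:R)) / (2 * k%:R).
    by rewrite /r; field; rewrite gt_eqF.
  by rewrite ltr_pdivrMr ?mul1r// mulr_gt0.
(* if etam > etap the statement is vacuous *)
have [etam_ep|] := boolP (etam <= etap); last first.
  move=> emp; exists 1, 1; split => // V x eta delta _ /andP[h1 h2].
  by rewrite (le_trans h1 h2) in emp.
have ep0 : 0 < etap by exact: lt_le_trans etam_ep.
pose K := (2 * g)^-1 + 1.
have K0 : 0 < K by rewrite addr_gt0// invr_gt0 mulr_gt0.
pose E0 := k%:R * (L / 2) ^+ 2.
have E0pos : 0 < E0 by rewrite mulr_gt0// exprn_gt0// divr_gt0.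
pose C1 := etap * r * (K * E0).
pose C2 := 2 * (etap * r) ^+ 2.
have er0 : 0 < etap * r by exact: mulr_gt0.
have C1_ge0 : 0 < C1 by apply: mulr_gt0 => //; exact: mulr_gt0.
have C2_ge0 : 0 < C2 by apply: mulr_gt0 => //; exact: exprn_gt0.
exists (etam * r * (g / 2)), (C1 + C2 + C2 * E0); split.
- by apply: mulr_gt0; [exact: mulr_gt0|exact: divr_gt0].
- by rewrite !addr_gt0//; exact: mulr_gt0.
move=> V x eta delta SV /andP[em ep] d0 /=.
have e0 : 0 < eta by exact: lt_le_trans em.
pose G i := dot (grad f x) (col i V).
pose a i := (f (x + delta *: col i V) - f (x - delta *: col i V)) / (2 * delta).
pose e i := a i - G i.
have aE i : a i = G i + e i by rewrite /e addrC subrK.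
have eB i : e i ^+ 2 <= (L / 2) ^+ 2 * delta ^+ 2.
  have h : `|e i| <= L / 2 * delta.
    rewrite mulrAC.
    by apply: central_difference_error; rewrite ?stiefel_dot ?eqxx.
  rewrite -exprMn -(real_normK (num_real (e i))) lerXn2r ?nnegrE ?normr_ge0//.
  exact: le_trans (normr_ge0 _) h.
have eS : \sum_i e i ^+ 2 <= E0 * delta ^+ 2.
  apply: (le_trans (ler_sum _ (fun i _ => eB i))).
  by rewrite sumr_const card_ord -[leLHS]mulr_natl /E0 mulrA.
have pE : proj_energy V (grad f x) = \sum_i G i ^+ 2 by [].
set p := proj_energy _ _ in pE *.
have p0 : 0 <= p by exact: proj_energy_ge0.
have zE : eta *: zo_grad f V delta x = (eta * r) *: \sum_i a i *: col i V.
  rewrite /zo_grad !scaler_sumr; apply: eq_bigr => i _.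
  rewrite !scalerA /a /r; congr (_ *: _); field.
  by rewrite !gt_eqF.
set al := eta * r in zE.
have al0 : 0 < al by rewrite mulr_gt0.
have alm : etam * r <= al by rewrite ler_pM2r.
have alp : al <= etap * r by rewrite ler_pM2r.
rewrite zE; set S := \sum_i a i *: col i V.
have SS : dot S S = \sum_i a i ^+ 2 by exact: stiefel_dot_sum.
have gS : dot (grad f x) S = \sum_i a i * G i.
  by rewrite dot_sumr; apply: eq_bigr => i _; rewrite dotZr.
split.
- have := smooth_descent L0 f_smooth x (- (al *: S)).
  rewrite !(dotNl, dotNr, dotZl, dotZr) opprK SS gS ler_norml => /andP[_ h].
  have {h} : f (x - al *: S) <= f x + al *
      \sum_i (- (G i + e i) * G i + (L * al / 2) * (G i + e i) ^+ 2).
    rewrite big_split/= -mulr_sumr.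
    have -> : \sum_i - (G i + e i) * G i = - \sum_i a i * G i.
      by rewrite -sumrN; apply: eq_bigr => i _; rewrite aE mulNr.
    have -> : \sum_i (G i + e i) ^+ 2 = \sum_i a i ^+ 2.
      by apply: eq_bigr => i _; rewrite aE.
    lra.
  move=> h; apply: (le_trans h).
  have b1 : 0 <= L * al / 2.
    by apply: divr_ge0 => //; apply: mulr_ge0; exact: ltW.
  have b2 : g <= 1 - L * al / 2.
    rewrite /g lerD2l lerN2 ler_pM2r ?invr_gt0// -mulrA ler_pM2l//.
  have : \sum_i (- (G i + e i) * G i + (L * al / 2) * (G i + e i) ^+ 2)
      <= - (g / 2 * p) + K * (E0 * delta ^+ 2).
    apply: (@le_trans _ _ (\sum_i (- (g / 2 * G i ^+ 2) + K * e i ^+ 2))).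
      by apply: ler_sum => i _; exact: young_descent_term.
    rewrite big_split/= sumrN -!mulr_sumr -pE lerD2l.
    by rewrite ler_pM2l.
  rewrite -(ler_pM2l al0) => h2.
  have h3 : etam * r * (g / 2 * p) <= al * (g / 2 * p).
    by apply: ler_wpM2r => //; apply: mulr_ge0 => //; exact: ltW (divr_gt0 _ _).
  have h4 : al * (K * (E0 * delta ^+ 2)) <= etap * r * (K * (E0 * delta ^+ 2)).
    apply: ler_wpM2r => //; apply: mulr_ge0; first exact: ltW.
    by apply: mulr_ge0; [exact: ltW|exact: sqr_ge0].
  have h5 : 0 <= (C2 + C2 * E0) * delta ^+ 2.
    apply: mulr_ge0; last exact: sqr_ge0.
    by apply: addr_ge0; [exact: ltW|exact: ltW (mulr_gt0 _ _)].
  move: h5; rewrite /C1; lra.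
- have -> : x - al *: S - x = - (al *: S) by rewrite addrAC subrr add0r.
  rewrite enorm_sqr !(dotNl, dotNr, dotZl, dotZr) mulrN opprK SS.
  have h1 : \sum_i a i ^+ 2 <= 2 * (p + E0 * delta ^+ 2).
    apply: (@le_trans _ _ (\sum_i (2 * (G i ^+ 2 + e i ^+ 2)))).
      apply: ler_sum => i _; rewrite aE.
      by have := sqr_ge0 (G i - e i); lra.
    by rewrite -mulr_sumr ler_pM2l// big_split/= -pE lerD2l.
  have h2 : al * (al * \sum_i a i ^+ 2) <= C2 * (p + E0 * delta ^+ 2).
    rewrite /C2 mulrA -expr2 (mulrC 2) -[leRHS]mulrA.
    apply: ler_pM => //; first exact: sqr_ge0.
    + by apply: sumr_ge0 => i _; exact: sqr_ge0.
    + by rewrite lerXn2r ?nnegrE ?(ltW al0) ?(ltW er0).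
  apply: (le_trans h2).
  have := mulr_ge0 (ltW C1_ge0) p0.
  have := mulr_ge0 (ltW C2_ge0) (sqr_ge0 delta).
  have := mulr_ge0 (ltW C1_ge0) (sqr_ge0 delta).
  have := mulr_ge0 (mulr_ge0 (ltW C2_ge0) (ltW E0pos)) p0.
  lra.
Qed.

End fixed_frame.

(** * Borel measurability of matrix-valued maps *)

Lemma dist_lt_double (R : realFieldType) (a b c e r : R) :
  `|a - b| < r -> `|a - c| < r -> r < e / 2 -> `|b - c| < e.
Proof.
move=> ab ac re; rewrite -[b](subrK a) -addrA.
by apply: (le_lt_trans (ler_normD _ _)); rewrite distrC; lra.
Qed.

(** Equivalent to measurability for the Borel sets of the matrix space, but
stable under arithmetic on entries, which is how iterates are built. *)
Definition entries_measurable (R : realType) (m n : nat) (d : measure_display)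
    (T : measurableType d) (Y : T -> 'M[R]_(m, n)) : Prop :=
  forall i j, measurable_fun setT (fun w => Y w i j).

(** Balls of the matrix topology are boxes, so an open set is the union of the
countably many boxes with rational centre and radius 1/(N+1) that it contains,
and the preimage of a box is a finite intersection of entry conditions. *)
Lemma entries_measurable_open (R : realType) (m n : nat) (d : measure_display)
    (T : measurableType d) (Y : T -> 'M[R]_(m, n)) (U : set 'M[R]_(m, n)) :
  entries_measurable Y -> open U -> measurable (Y @^-1` U).
Proof.
move=> mY oU.
(* F q keeps the boxes contained in U and empties the other ones, so that the
   union can run over all pairs of a rational matrix and a natural number *)
pose box (q : 'M[rat]_(m, n) * nat) : set 'M[R]_(m, n) :=
  [set y | forall i j, `|ratr (q.1 i j) - y i j| < q.2.+1%:R^-1].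
pose F q := if `[< box q `<=` U >] then Y @^-1` box q else set0.
rewrite (_ : _ @^-1` _ = \bigcup_q F q).
  apply: countable_bigcupT_measurable => // q; rewrite /F.
  case: asboolP => // _.
  rewrite (_ : _ @^-1` _ = \bigcap_(i in setT) \bigcap_(j in setT)
      ((fun w => `|ratr (q.1 i j) - Y w i j|) @^-1` `]-oo, q.2.+1%:R^-1[)).
    apply: fin_bigcap_measurable => // i _.
    apply: fin_bigcap_measurable => // j _.
    rewrite -[X in measurable X]setTI.
    have mf : measurable_fun setT (fun w => `|ratr (q.1 i j) - Y w i j|).
      apply: measurableT_comp => //; apply: measurable_funB => //.
    by apply: mf => //; exact: measurable_itv.
  apply/seteqP; split => w /=.
    by move=> h i _ j _; rewrite /= in_itv/= h.
  by move=> h i j; have := h i I j I; rewrite /= in_itv.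
apply/seteqP; split => w /=; last first.
  by move=> [q _]; rewrite /F; case: asboolP => // h /h.
move=> Uw.
have /nbhs_ballP[e /= e0 eU] : nbhs (Y w) U by exact: open_nbhs_nbhs.
have [N hN] : exists N : nat, N.+1%:R^-1 < e / 2.
  have /ltr_add_invr[N] : 0 < e / 2 by rewrite divr_gt0.
  by rewrite add0r => h; exists N.
have N0 : 0 < N.+1%:R^-1 :> R by rewrite invr_gt0.
have hq i j : exists q : rat, `|ratr q - Y w i j| < N.+1%:R^-1.
  have /rat_in_itvoo[q] : Y w i j - N.+1%:R^-1 < Y w i j + N.+1%:R^-1.
    by rewrite ltrBlDr -addrA ltrDl addr_gt0.
  by rewrite in_itv/= => h; exists q; rewrite ltr_distl.
exists ((\matrix_(i, j) sval (cid (hq i j))), N) => //.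
rewrite /F; case: asboolP => [_|].
  by move=> i j /=; rewrite mxE; case: (cid (hq i j)).
apply: contra_notP => _ y hy; apply: eU; split => // i j.
have := hy i j; rewrite /= mxE; case: (cid (hq i j)) => q /= h1 h2.
rewrite /ball/=; exact: dist_lt_double h1 h2 hN.
Qed.

Lemma measurable_of_open (R : realType) (d : measure_display)
    (T : measurableType d) (g : T -> R) :
  (forall U, open U -> measurable (g @^-1` U)) -> measurable_fun setT g.
Proof.
move=> gU; apply: (measurability _ (RGenOpens.measurableE R)).
move=> _ [_ [a [b ->] <-]]; rewrite setTI; apply: gU; exact: interval_open.
Qed.

Lemma entries_measurable_continuous (R : realType) (m n : nat)
    (d : measure_display) (T : measurableType d) (Y : T -> 'M[R]_(m, n))
    (g : 'M[R]_(m, n) -> R) :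
  entries_measurable Y -> continuous g ->
  measurable_fun setT (fun w => g (Y w)).
Proof.
move=> mY /continuousP cg; apply: measurable_of_open => U oU.
apply: (entries_measurable_open mY (cg _ oU)).
Qed.

Lemma borel_entries_measurable (R : realType) (m n : nat)
    (d : measure_display) (T : measurableType d) (Y : T -> 'M[R]_(m, n)) :
  (forall A, borel_mx A -> measurable (Y @^-1` A)) -> entries_measurable Y.
Proof.
move=> mY i j; apply: measurable_of_open => U oU.
apply: (mY ((fun M : 'M[R]_(m, n) => M i j) @^-1` U)).
apply: sub_gen_smallest; move: U oU; apply/continuousP; exact: coord_continuous.
Qed.

(** The space of matrices with its Borel sets, so that a Borel function on
matrices is a measurable function on this type. *)
Definition borel_mxType (R : realType) (m n : nat) :=
  g_sigma_algebraType (@open 'M[R]_(m, n)).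

Lemma entries_measurable_id (R : realType) (m n : nat) :
  entries_measurable (id : borel_mxType R m n -> 'M[R]_(m, n)).
Proof. exact: borel_entries_measurable. Qed.

Lemma borel_mx_preimage (R : realType) (m n : nat)
    (g : borel_mxType R m n -> R) (B : set R) :
  measurable_fun setT g -> measurable B ->
  borel_mx ((g : 'M[R]_(m, n) -> R) @^-1` B).
Proof. by move=> mg mB; have := mg measurableT B mB; rewrite setTI. Qed.

(** * Real-valued expectations *)

Section expectation.
Context (d : measure_display) (Omega : measurableType d) (R : realType)
  (P : probability Omega R).
Implicit Types X Y : Omega -> R.

Lemma ae_bounded_integrable X (M : R) : measurable_fun setT X ->
  {ae P, forall w, `|X w| <= M} -> P.-integrable setT (EFin \o X).
Proof.
move=> mX XM; apply/integrableP; split; first exact/measurable_EFinP.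
apply: (@le_lt_trans _ _ (`|M|%:E * P setT)%E); last first.
  by rewrite probability_setT mule1 ltry.
apply: integral_le_bound => //; first exact/measurable_EFinP.
by apply: filterS XM => w h _; rewrite lee_fin (le_trans h)// ler_norm.
Qed.

Lemma Rintegral_const (r : R) : \int[P]_w r = r.
Proof.
rewrite Rintegral_cst// -[RHS]mulr1; congr (_ * _).
exact: (congr1 fine (probability_setT P)).
Qed.

Lemma Rintegral_sum (I : Type) (s : seq I) (F : I -> Omega -> R) :
  (forall i, P.-integrable setT (EFin \o F i)) ->
  \int[P]_w (\sum_(i <- s) F i w) = \sum_(i <- s) \int[P]_w F i w.
Proof.
move=> iF; elim: s => [|i s IH].
  rewrite big_nil -[RHS](mul0r (fine (P setT))) -Rintegral_cst//.
  by apply: eq_Rintegral => w _; rewrite big_nil.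
rewrite big_cons -IH -RintegralD//; last first.
  rewrite (_ : _ \o _ = (fun w => \sum_(j <- s) (EFin \o F j) w)%E).
    by apply: integrable_sum => // j _; exact: iF.
  by apply/funext => w; rewrite /= sumEFin.
by apply: eq_Rintegral => w _; rewrite big_cons.
Qed.

Lemma ae_le_Rintegral X Y :
  P.-integrable setT (EFin \o X) -> P.-integrable setT (EFin \o Y) ->
  {ae P, forall w, X w <= Y w} -> \int[P]_w X w <= \int[P]_w Y w.
Proof.
move=> iX iY XY; rewrite -subr_ge0 -RintegralB//.
have iYX : P.-integrable setT (EFin \o (Y \- X)).
  exact: (integrableB measurableT iY iX).
have iN : P.-integrable setT (EFin \o (Num.norm \o (Y \- X))).
  exact: integrable_norm.
suff -> : \int[P]_w (Y w - X w) = \int[P]_w `|Y w - X w|.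
  exact: Rintegral_ge0.
rewrite /Rintegral; congr fine; apply: ae_eq_integral => //.
- by case/integrableP: iYX.
- by case/integrableP: iN.
- by apply: filterS XY => w h _; rewrite ger0_norm// subr_ge0.
Qed.

(** Both sides are the integral of the identity against the common law. *)
Lemma eq_distribution_Rintegral X Y :
  P.-integrable setT (EFin \o X) -> P.-integrable setT (EFin \o Y) ->
  (forall B, measurable B -> P (X @^-1` B) = P (Y @^-1` B)) ->
  \int[P]_w X w = \int[P]_w Y w.
Proof.
move=> iX iY XY.
have mX : measurable_fun setT X by apply/measurable_EFinP; case/integrableP: iX.
have mY : measurable_fun setT Y by apply/measurable_EFinP; case/integrableP: iY.
pose X' : {mfun Omega >-> R} := mfun_Sub (mem_set mX : X \in mfun).
pose Y' : {mfun Omega >-> R} := mfun_Sub (mem_set mY : Y \in mfun).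
rewrite /Rintegral; congr fine.
rewrite -[LHS](@integral_distribution _ _ _ _ _ P X' EFin)//.
rewrite -[RHS](@integral_distribution _ _ _ _ _ P Y' EFin)//.
by apply: eq_measure_integral => A mA _; exact: XY.
Qed.

(** Independence says that the law of (X, Y) and the product of the laws
agree on rectangles, hence everywhere, and Fubini's theorem separates the
variables. *)
Lemma Rintegral_mul_independent X Y :
  P.-integrable setT (EFin \o X) -> P.-integrable setT (EFin \o Y) ->
  P.-integrable setT (EFin \o (X \* Y)) ->
  (forall A B, measurable A -> measurable B ->
    P (X @^-1` A `&` Y @^-1` B) = (P (X @^-1` A) * P (Y @^-1` B))%E) ->
  \int[P]_w (X w * Y w) = \int[P]_w X w * \int[P]_w Y w.
Proof.
move=> iX iY iXY indep.
have mX : measurable_fun setT X by apply/measurable_EFinP; case/integrableP: iX.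
have mY : measurable_fun setT Y by apply/measurable_EFinP; case/integrableP: iY.
pose X' : {mfun Omega >-> R} := mfun_Sub (mem_set mX : X \in mfun).
pose Y' : {mfun Omega >-> R} := mfun_Sub (mem_set mY : Y \in mfun).
have mZ : measurable_fun setT (fun w => (X w, Y w)).
  exact: measurable_fun_pair.
pose Z : {mfun Omega >-> (R * R)%type} :=
  mfun_Sub (mem_set mZ : (fun w => (X w, Y w)) \in mfun).
pose mu1 := distribution P X'.
pose mu2 := distribution P Y'.
pose mu := distribution P Z.
pose g (z : R * R) : \bar R := (z.1 * z.2)%:E.
have mg : measurable_fun setT g.
  apply/measurable_EFinP; apply: measurable_funM.
    exact: measurable_fst.
  exact: measurable_snd.
have muE A : measurable A -> (mu1 \x mu2)%E A = mu A.
  by move=> mA; exact: product_measure_unique.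
have ig : mu.-integrable setT g by apply: integrable_pushforward.
have ig' : (mu1 \x mu2)%E.-integrable setT g.
  apply/integrableP; split => //; case/integrableP: ig => _.
  apply: le_lt_trans; rewrite le_eqVlt; apply/orP; left; apply/eqP.
  by apply: eq_measure_integral => A mA _; exact: muE.
have E1 : (\int[P]_w (X w * Y w)%:E = \int[mu]_z g z)%E.
  by rewrite integral_distribution.
have E2 : (\int[mu]_z g z = \int[mu1 \x mu2]_z g z)%E.
  by apply: eq_measure_integral => A mA _; exact/esym/muE.
have i2 : mu2.-integrable setT EFin by apply: integrable_pushforward.
have i1 : mu1.-integrable setT EFin by apply: integrable_pushforward.
have F2 : (\int[mu2]_y y%:E = \int[P]_w (Y w)%:E)%E.
  by rewrite integral_distribution.
have F1 : (\int[mu1]_y y%:E = \int[P]_w (X w)%:E)%E.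
  by rewrite integral_distribution.
rewrite /Rintegral E1 E2 -(integral12_prod_meas1 ig') /fubini_F /g /=.
have fY : (\int[P]_w (Y w)%:E)%E \is a fin_num by exact: integrable_fin_num.
have fX : (\int[P]_w (X w)%:E)%E \is a fin_num by exact: integrable_fin_num.
rewrite -fineM// -F1 -F2; congr fine.
transitivity (\int[mu1]_x (x%:E * \int[mu2]_y y%:E))%E.
  by apply: eq_integral => x _; rewrite -integralZl//.
by rewrite F2 -(fineK fY) integralZr.
Qed.

End expectation.

(** * Independence of a frame from the preceding ones *)

Lemma borel_mxT (R : realType) (m n : nat) : borel_mx [set: 'M[R]_(m, n)].
Proof. by apply: sub_gen_smallest; exact: openT. Qed.

Lemma borel_mxI (R : realType) (m n : nat) (A B : set 'M[R]_(m, n)) :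
  borel_mx A -> borel_mx B -> borel_mx (A `&` B).
Proof.
exact: (@measurableI _ (borel_mxType R m n)).
Qed.

(** The events that constrain the frames before time t separately; a pi-system
on which the product rule is immediate. *)
Definition cylinders (R : realType) (n k : nat) (Omega : Type)
    (V : nat -> Omega -> 'M[R]_(n, k)) (t : nat) : set (set Omega) :=
  [set C | exists2 A : nat -> set 'M[R]_(n, k),
    (forall j, borel_mx (A j)) & C = \bigcap_(j in `I_t) (V j @^-1` A j)].

(** The sample space with the sigma-algebra generated by the frames before time
t. As a measurable type on the same carrier it lets
measurable_fun express measurability with respect to the past. *)
Definition history (R : realType) (n k : nat) (d : measure_display)
    (Omega : measurableType d) (V : nat -> Omega -> 'M[R]_(n, k)) (t : nat) :=
  g_sigma_algebraType (cylinders V t).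

Section independence_from_history.
Variables (R : realType) (n k : nat) (d : measure_display).
Variables (Omega : measurableType d) (P : probability Omega R).
Variable V : nat -> Omega -> 'M[R]_(n, k).
Hypothesis V_meas : forall t A, borel_mx A -> measurable (V t @^-1` A).
Hypothesis V_indep : mutually_independent P V.

Lemma setI_closed_cylinders t : setI_closed (cylinders V t).
Proof.
move=> _ _ [A bA ->] [B bB ->]; exists (fun j => A j `&` B j).
  by move=> j; exact: borel_mxI.
by rewrite -bigcapI.
Qed.

Lemma cylinder_measurable t C : cylinders V t C -> measurable C.
Proof.
move=> [A bA ->]; apply: bigcap_measurableType => j _; exact: V_meas.
Qed.

(** Mutual independence for the frames 0, ..., t, with A as constraint on the
last one, compared with mutual independence for 0, ..., t - 1. *)
Lemma cylinder_indep t C A : cylinders V t C -> borel_mx A ->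
  P (C `&` V t @^-1` A) = (P C * P (V t @^-1` A))%E.
Proof.
move=> [B bB ->] bA.
pose J := [fset j in iota 0 t]%fset.
have JE : [set` J] = `I_t.
  by apply/seteqP; split => j /=; rewrite inE mem_iota add0n.
(* the constraint A on the frame t extends the cylinder to 0, ..., t *)
pose B' j := if j == t then A else B j.
have bB' j : borel_mx (B' j) by rewrite /B'; case: ifP.
have tJ : t \notin J by rewrite inE mem_iota add0n ltnn andbF.
have B'E j : j \in J -> B' j = B j.
  by rewrite inE mem_iota add0n /B' => /andP[_ /ltn_eqF ->].
have -> : \bigcap_(j in `I_t) (V j @^-1` B j) `&` V t @^-1` A =
    \bigcap_(j in [set` (t |` J)%fset]) (V j @^-1` B' j).
  apply/seteqP; split => w /=.
    move=> [h wA] j /=; rewrite in_fset1U /B'.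
    case: eqVneq => [->//|_ /= jJ]; apply: h.
    by rewrite -JE.
  move=> h; split; last by have := h t; rewrite /= fset1U1 /B' eqxx; exact.
  move=> j; rewrite -JE => jJ; rewrite /= -B'E//; apply: h.
  by rewrite /= fset1Ur.
have B't : B' t = A by rewrite /B' eqxx.
rewrite (V_indep _ bB') big_fsetU1//= B't muleC; congr (_ * _)%E.
rewrite -JE (V_indep _ bB); apply: eq_big_seq => j jJ.
by rewrite B'E.
Qed.

(** Dynkin's pi-lambda theorem: the events independent of a fixed event of
V t form a lambda-system that contains the cylinders. *)
Lemma history_indep t (B : set Omega) (A : set 'M[R]_(n, k)) :
  <<s cylinders V t >> B -> borel_mx A ->
  P (B `&` V t @^-1` A) = (P B * P (V t @^-1` A))%E.
Proof.
move=> hB bA; set W := V t @^-1` A.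
have mW : measurable W by exact: V_meas.
have Pfin S : measurable S -> P S \is a fin_num by exact: fin_num_measure.
suff : <<s cylinders V t >> `<=`
    [set S | measurable S /\ P (S `&` W) = (P S * P W)%E].
  by move=> /(_ _ hB)[].
rewrite -setI_closed_g_dynkin_g_sigma_algebra; last first.
  exact: setI_closed_cylinders.
apply: smallest_sub; last first.
  move=> C cC; split; first exact: cylinder_measurable cC.
  exact: cylinder_indep.
split.
- by split => //; rewrite setTI probability_setT mul1e.
- move=> S [mS SW]; split; first exact: measurableC.
  rewrite setIC -setDE measureD ?ltry//; last first.
    by rewrite (le_lt_trans (probability_le1 _ _)) ?ltry.
  transitivity (P W - P S * P W)%E.
    by congr (_ - _)%E; rewrite setIC; exact: SW.
  by rewrite probability_setC// muleBl ?mul1e// ?Pfin//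
    fin_num_adde_defl// fin_numN Pfin.
- move=> F tF mF; have mF1 i : measurable (F i) by case: (mF i).
  split; first exact: bigcupT_measurable.
  rewrite setI_bigcupl measure_bigcup//; last 2 first.
  + by move=> i _; exact: measurableI.
  + by under eq_fun do rewrite setIC; exact: trivIset_setIl.
  rewrite measure_bigcup// muleC -(fineK (Pfin _ mW)) -nneseriesZl//.
  by apply: eq_eseriesr => i _; case: (mF i) => _ FiW; apply: (etrans FiW);
    rewrite fineK ?Pfin// muleC.
Qed.

Lemma entries_measurable_history t j : (j < t)%N ->
  entries_measurable (V j : history V t -> 'M[R]_(n, k)).
Proof.
move=> jt; apply: borel_entries_measurable => A bA.
apply: sub_gen_smallest; exists (fun i => if i == j then A else setT).
  by move=> i; case: ifP => // _; exact: borel_mxT.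
apply/seteqP; split => w /=.
  by move=> wA i _ /=; case: eqP => [->|].
by move=> /(_ j jt); rewrite /= eqxx.
Qed.

Lemma Rintegral_history_mul t (h : history V t -> R)
    (g : borel_mxType R n k -> R) :
  measurable_fun setT h -> measurable_fun setT g ->
  P.-integrable setT (EFin \o (h : Omega -> R)) ->
  P.-integrable setT (EFin \o (fun w => g (V t w))) ->
  P.-integrable setT (EFin \o (fun w => (h w * g (V t w)))) ->
  \int[P]_w (h w * g (V t w)) = \int[P]_w h w * \int[P]_w g (V t w).
Proof.
move=> mh mg ih ig ihg; apply: Rintegral_mul_independent => // A B mA mB.
apply: (@history_indep t ((h : Omega -> R) @^-1` A)
  ((g : 'M[R]_(n, k) -> R) @^-1` B)); last first.
  exact: borel_mx_preimage.
by have := mh measurableT A mA; rewrite setTI.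
Qed.

End independence_from_history.

(** * Second moments of a uniform frame *)

Section gram_moment.
Variables (R : realType) (n k : nat).
Implicit Types (M : 'M[R]_(n, k)).

Lemma gramE M i j : (M *m M^T) i j = \sum_(l < k) M i l * M j l.
Proof. by rewrite mxE; apply: eq_bigr => l _; rewrite mxE. Qed.

Lemma proj_energy_gram M (u : 'cV[R]_n) :
  proj_energy M u = \sum_i \sum_j u i 0 * u j 0 * (M *m M^T) i j.
Proof.
rewrite /proj_energy.
transitivity (\sum_(l < k) \sum_i \sum_j u i 0 * u j 0 * (M i l * M j l)).
  apply: eq_bigr => l _; rewrite expr2 {1}/dot mulr_suml.
  apply: eq_bigr => i _; rewrite /dot mulr_sumr.
  by apply: eq_bigr => j _; rewrite !mxE; ring.
rewrite exchange_big; apply: eq_bigr => i _.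
rewrite exchange_big; apply: eq_bigr => j _.
by rewrite gramE mulr_sumr.
Qed.

Lemma gram_entry_measurable (d : measure_display) (T : measurableType d)
    (Y : T -> 'M[R]_(n, k)) i j :
  entries_measurable Y -> measurable_fun setT (fun w => (Y w *m (Y w)^T) i j).
Proof.
move=> mY; under eq_fun => w do rewrite gramE.
by apply: measurable_sum => l; apply: measurable_funM; exact: mY.
Qed.

Lemma stiefel_gram_le M i j : stiefel M -> `|(M *m M^T) i j| <= k%:R.
Proof.
move=> SM; have M1 a l : `|M a l| <= 1.
  rewrite -(@ler_pXn2r _ 2)// ?nnegrE// expr1n real_normK ?num_real//.
  have := sqr_coord_le (col l M) a.
  by rewrite stiefel_dot// eqxx mxE.
rewrite gramE; apply: (le_trans (ler_norm_sum _ _ _)).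
apply: (@le_trans _ _ (\sum_(l < k) 1)).
  by apply: ler_sum => l _; rewrite normrM mulr_ile1.
by rewrite sumr_const card_ord.
Qed.

Variables (d : measure_display) (Omega : measurableType d).
Variables (P : probability Omega R) (V : Omega -> 'M[R]_(n, k)).
Hypothesis V_unif : uniform_stiefel P V.

Let mV : entries_measurable V.
Proof. by case: V_unif => mV _ _; exact: borel_entries_measurable. Qed.

Lemma integrable_gram i j :
  P.-integrable setT (EFin \o (fun w => (V w *m (V w)^T) i j)).
Proof.
apply: (@ae_bounded_integrable _ _ _ _ _ k%:R).
  exact: gram_entry_measurable.
by case: V_unif => _ SV _; apply: filterS SV => w; exact: stiefel_gram_le.
Qed.

(** Rotating a uniform frame does not change its law; the Gram matrix becomes
U V V^T U^T. *)
Lemma Rintegral_gram_rotate (U : 'M[R]_n) i j : U^T *m U = 1%:M ->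
  \int[P]_w ((U *m V w) *m (U *m V w)^T) i j = \int[P]_w (V w *m (V w)^T) i j.
Proof.
move=> oU; apply: eq_distribution_Rintegral; last 2 first.
- exact: integrable_gram.
- move=> B mB; case: V_unif => _ _ /(_ U oU) h.
  apply: (h ((fun M : 'M[R]_(n, k) => (M *m M^T) i j) @^-1` B)).
  apply: borel_mx_preimage mB; apply: gram_entry_measurable.
  exact: entries_measurable_id.
apply: (@ae_bounded_integrable _ _ _ _ _ k%:R).
  apply: gram_entry_measurable => a b.
  under eq_fun => w do rewrite mxE.
  by apply: measurable_sum => l; apply: measurable_funM => //; exact: mV.
case: V_unif => _ SV _; apply: filterS SV => w SVw; apply: stiefel_gram_le.
by rewrite /stiefel/= trmx_mul mulmxA -(mulmxA _ U^T) oU mulmx1.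
Qed.

(** Reflecting the i-th coordinate changes the sign of the entry. *)
Lemma Rintegral_gram_offdiag i j : i != j ->
  \int[P]_w (V w *m (V w)^T) i j = 0.
Proof.
move=> ij.
pose e : 'rV[R]_n := \row_a (if a == i then -1 else 1).
have oU : (diag_mx e)^T *m diag_mx e = 1%:M.
  rewrite tr_diag_mx mulmx_diag -diag_const_mx; congr diag_mx.
  by apply/rowP => a; rewrite !mxE; case: ifP; rewrite ?mulrNN mulr1.
have := Rintegral_gram_rotate i j oU.
have -> : \int[P]_w ((diag_mx e *m V w) *m (diag_mx e *m V w)^T) i j =
    \int[P]_w (-1 * (V w *m (V w)^T) i j).
  apply: eq_Rintegral => w _; rewrite !gramE mulr_sumr; apply: eq_bigr => l _.
  by rewrite mul_diag_mx !mxE eqxx eq_sym (negbTE ij) mul1r mulrA.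
rewrite RintegralZl//; last exact: integrable_gram.
by lra.
Qed.

(** Exchanging coordinates i and j exchanges the two entries. *)
Lemma Rintegral_gram_diag_eq i j :
  \int[P]_w (V w *m (V w)^T) i i = \int[P]_w (V w *m (V w)^T) j j.
Proof.
pose s := tperm i j.
have oU : (perm_mx s)^T *m perm_mx s = 1%:M :> 'M[R]_n.
  by rewrite tr_perm_mx -perm_mxM mulVg perm_mx1.
rewrite -(Rintegral_gram_rotate j j oU); apply: eq_Rintegral => w _.
rewrite -row_permE !gramE; apply: eq_bigr => l _.
by rewrite !mxE tpermR.
Qed.

Hypotheses (n_gt0 : (0 < n)%N).

(** The trace of V V^T is that of V^T V = I, which is k. *)
Lemma Rintegral_gram_trace : \sum_i \int[P]_w (V w *m (V w)^T) i i = k%:R.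
Proof.
rewrite -Rintegral_sum; last by move=> i; exact: integrable_gram.
transitivity (\int[P]_w (k%:R : R)).
  have mT : measurable_fun setT (fun w => \sum_i (V w *m (V w)^T) i i).
    by apply: measurable_sum => i; exact: gram_entry_measurable.
  rewrite /Rintegral; congr fine; apply: ae_eq_integral => //.
    exact/measurable_EFinP.
  case: V_unif => _ SV _; apply: filterS SV => w SVw _; congr EFin.
  by rewrite -/(\tr _) mxtrace_mulC SVw mxtrace1.
exact: Rintegral_const.
Qed.

Lemma Rintegral_gram i j :
  \int[P]_w (V w *m (V w)^T) i j = (i == j)%:R * (k%:R / n%:R).
Proof.
case: eqVneq => [->|ij]; last by rewrite mul0r Rintegral_gram_offdiag.
rewrite mul1r -Rintegral_gram_trace.
rewrite (eq_bigr (fun=> \int[P]_w (V w *m (V w)^T) j j)); last first.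
  by move=> a _; exact: Rintegral_gram_diag_eq.
by rewrite sumr_const card_ord -[X in X / _]mulr_natr mulfK// pnatr_eq0 -lt0n.
Qed.

End gram_moment.

(** * Expected squared projection of the gradient *)

Lemma szgd_entries_measurable (R : realType) (n k : nat)
    (d : measure_display) (T : measurableType d) (V : nat -> T -> 'M[R]_(n, k))
    (f : 'cV[R]_n -> R) (eta : nat -> R) (delta0 : R) (x0 : 'cV[R]_n) t :
  continuous f -> (forall s, (s < t)%N -> entries_measurable (V s)) ->
  entries_measurable (fun w => szgd f eta delta0 x0 (fun s => V s w) t).
Proof.
move=> cf; elim: t => [|t IH] mV i j; first exact: measurable_cst.
have mx : entries_measurable (fun w => szgd f eta delta0 x0 (fun s => V s w) t).
  by apply: IH => s st; apply: mV; exact: ltn_trans st _.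
have mVt := mV t (ltnSn t).
have mf (e : R) (l : 'I_k) : measurable_fun setT (fun w =>
    f (szgd f eta delta0 x0 (fun s => V s w) t + e *: col l (V t w))).
  apply: (@entries_measurable_continuous _ _ _ _ _ _ f) => // a b.
  under eq_fun => w do rewrite !mxE.
  by apply: measurable_funD => //; apply: measurable_funM => //; exact: mVt.
under eq_fun => w do rewrite /= /zo_grad !mxE summxE.
apply: measurable_funB; first exact: mx.
apply: measurable_funM => //; apply: measurable_funM => //.
apply: measurable_sum => l; under eq_fun => w do rewrite !mxE.
apply: measurable_funM; last exact: mVt.
apply: measurable_funB; first exact: mf.
by under eq_fun => w do rewrite -scaleNr; exact: mf.
Qed.

Section conditional_energy.
Variables (R : realType) (n k : nat) (d : measure_display).
Variables (Omega : measurableType d) (P : probability Omega R).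
Variable V : nat -> Omega -> 'M[R]_(n, k).
Hypothesis n_gt0 : (0 < n)%N.
Hypothesis V_unif : forall t, uniform_stiefel P (V t).
Hypothesis V_indep : mutually_independent P V.

Let V_meas t A : borel_mx A -> measurable (V t @^-1` A).
Proof. by case: (V_unif t) => + _ _; apply. Qed.

(** Expanding the square gives products of an entry of u u^T, which belongs to
the past, and an entry of V V^T, which is independent of it; the moments of
the latter are those of (k/n) I. *)
Lemma Rintegral_proj_energy t (u : Omega -> 'cV[R]_n) (M : R) :
  entries_measurable (u : history V t -> 'cV[R]_n) -> entries_measurable u ->
  {ae P, forall w, dot (u w) (u w) <= M ^+ 2} ->
  \int[P]_w proj_energy (V t w) (u w) =
    k%:R / n%:R * \int[P]_w dot (u w) (u w).
Proof.
move=> mu_hist mu ubnd.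
pose h i j w := u w i 0 * u w j 0.
pose g i j w := (V t w *m (V t w)^T) i j.
have mV : entries_measurable (V t).
  by apply: borel_entries_measurable => A; exact: V_meas.
have mh i j : measurable_fun setT (h i j) by apply: measurable_funM; exact: mu.
have mg i j : measurable_fun setT (g i j) by exact: gram_entry_measurable.
have hbnd : {ae P, forall w, forall i j, `|h i j w| <= M ^+ 2}.
  apply: filterS ubnd => w hw i j; rewrite /h normrM.
  have H a : `|u w a 0| <= `|M|.
    rewrite -(@ler_pXn2r _ 2)// ?nnegrE//.
    rewrite !real_normK ?num_real//; apply: le_trans hw; exact: sqr_coord_le.
  by rewrite -[leRHS]real_normK ?num_real// expr2 ler_pM ?H.
have gbnd : {ae P, forall w, forall i j, `|g i j w| <= k%:R}.
  case: (V_unif t) => _ SV _; apply: filterS SV => w SVw i j.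
  exact: stiefel_gram_le.
have ih i j : P.-integrable setT (EFin \o h i j).
  by apply: (ae_bounded_integrable (mh i j)); apply: filterS hbnd => w; apply.
have ihg i j : P.-integrable setT (EFin \o (fun w => h i j w * g i j w)).
  apply: (@ae_bounded_integrable _ _ _ _ _ (M ^+ 2 * k%:R)).
    exact: measurable_funM.
  by apply: filterS2 hbnd gbnd => w hw gw; rewrite normrM ler_pM.
have Ehg i j : \int[P]_w (h i j w * g i j w) =
    (i == j)%:R * (k%:R / n%:R) * \int[P]_w h i j w.
  rewrite (@Rintegral_history_mul _ _ _ _ _ P V V_meas V_indep t (h i j)
      (fun M => (M *m M^T) i j)) //.
  - by rewrite (Rintegral_gram (V_unif t)) 1?mulrC.
  - by apply: measurable_funM; exact: mu_hist.
  - by apply: gram_entry_measurable; exact: entries_measurable_id.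
  - exact: (integrable_gram (V_unif t)).
transitivity (\int[P]_w (\sum_i \sum_j h i j w * g i j w)).
  by apply: eq_Rintegral => w _; rewrite proj_energy_gram.
have ihgs i : P.-integrable setT (EFin \o (fun w => \sum_j h i j w * g i j w)).
  rewrite (_ : _ \o _ = (fun w =>
      \sum_j (EFin \o (fun w => (h i j w * g i j w)%R)) w)%E).
    by apply: integrable_sum => // j _; exact: ihg.
  by apply/funext => w; rewrite /= sumEFin.
rewrite Rintegral_sum// [in RHS]/dot Rintegral_sum; last first.
  by move=> i; exact: (ih i i).
rewrite mulr_sumr; apply: eq_bigr => i _.
rewrite Rintegral_sum// (bigD1 i)//= Ehg eqxx mul1r big1 ?addr0// => j ji.
by rewrite Ehg eq_sym (negbTE ji) !mul0r.
Qed.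

End conditional_energy.

(** Integrate the tangent of the power function at the mean of X. The
integrable bound Z plays the role of X^p. *)
Lemma jensen_powR (R : realType) (d : measure_display)
    (Omega : measurableType d) (P : probability Omega R) (p : R)
    (X Z : Omega -> R) :
  1 <= p -> (forall w, 0 <= X w) ->
  P.-integrable setT (EFin \o X) -> P.-integrable setT (EFin \o Z) ->
  {ae P, forall w, X w `^ p <= Z w} ->
  (\int[P]_w X w) `^ p <= \int[P]_w Z w.
Proof.
move=> p1 X0 iX iZ XZ; set a := \int[P]_w X w.
have : 0 <= a by exact: Rintegral_ge0.
rewrite le_eqVlt => /predU1P[<-|a0].
  rewrite powR0 ?gt_eqF ?(lt_le_trans ltr01 p1)//.
  rewrite -[leLHS](Rintegral_const P); apply: ae_le_Rintegral => //.
    exact: finite_measure_integrable_cst.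
  by apply: filterS XZ => w; apply: le_trans; exact: powR_ge0.
have ap : 0 < a `^ p by rewrite powR_gt0.
have iX' : P.-integrable setT (EFin \o (fun w => a `^ p * p / a * X w)).
  exact: (integrableZl measurableT (a `^ p * p / a) iX).
have ic (c : R) : P.-integrable setT (EFin \o (fun=> c)).
  exact: finite_measure_integrable_cst.
apply: (@le_trans _ _ (\int[P]_w (a `^ p * (1 - p) + a `^ p * p / a * X w))).
  rewrite RintegralD// (RintegralZl _ measurableT iX) Rintegral_const -/a.
  by rewrite le_eqVlt; apply/orP; left; apply/eqP; field; rewrite gt_eqF.
apply: ae_le_Rintegral => //.
  exact: (integrableD measurableT (ic (a `^ p * (1 - p))) iX').
apply: filterS XZ => w; apply: le_trans.
have -> : X w `^ p = a `^ p * (X w / a) `^ p.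
  by rewrite -powRM ?(ltW a0) ?divr_ge0 ?(ltW a0)// mulrC divfK ?gt_eqF.
have := powR_ge_tangent p1 (divr_ge0 (X0 w) (ltW a0)).
rewrite -(ler_pM2l ap); apply: le_trans.
by rewrite le_eqVlt; apply/orP; left; apply/eqP; field; rewrite gt_eqF.
Qed.

(** * The Lojasiewicz inequality and the Lyapunov sequence *)

Section near_critical_point.
Variables (R : realType) (n : nat) (f : 'cV[R]_n -> R) (L : R).
Hypotheses (L0 : 0 < L) (f_smooth : lsmooth L f).
Variables (xs : 'cV[R]_n) (mu : R).
Hypotheses (xs_crit : critical f xs) (mu0 : 0 < mu).

Let ball_dot x : enorm (x - xs) <= mu -> dot (x - xs) (x - xs) <= mu ^+ 2.
Proof.
by move=> h; rewrite -enorm_sqr lerXn2r ?nnegrE ?enorm_ge0// ltW.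
Qed.

Lemma ball_grad_le x : enorm (x - xs) <= mu ->
  dot (grad f x) (grad f x) <= (L * mu) ^+ 2.
Proof.
move=> /ball_dot h; have := lsmooth_dot L0 f_smooth x xs.
have -> : grad f xs = 0 by exact: xs_crit.
rewrite subr0 exprMn => /le_trans; apply.
by apply: ler_wpM2l => //; exact: sqr_ge0.
Qed.

Lemma ball_gap_le x : enorm (x - xs) <= mu -> `|f x - f xs| <= L / 2 * mu ^+ 2.
Proof.
move=> /ball_dot h; have := smooth_descent L0 f_smooth xs (x - xs).
have -> : grad f xs = 0 by exact: xs_crit.
rewrite dot0l subr0 (addrC xs) subrK => /le_trans; apply.
by apply: ler_wpM2l => //; rewrite divr_ge0// ltW.
Qed.

(** Squaring the Lojasiewicz inequality gives the exponent 2 theta. If that is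
less than 1, the missing factor of the gap to the power 1 - 2 theta is bounded
on the ball. *)
Lemma ball_gap_powR_le (theta kappa : R) : 0 < theta -> 0 < kappa ->
  lojasiewicz_at f theta xs kappa mu ->
  exists K : R, 0 < K /\ forall x, enorm (x - xs) <= mu ->
    `|f x - f xs| `^ (Num.max 1 (2 * theta)) <= K * dot (grad f x) (grad f x).
Proof.
move=> th0 k0 loja.
have loja2 x : enorm (x - xs) <= mu ->
    `|f x - f xs| `^ (2 * theta) <= kappa ^+ 2 * dot (grad f x) (grad f x).
  move=> /loja h; rewrite -enorm_sqr -exprMn mulrC powRrM.
  by rewrite powR_mulrn ?powR_ge0// lerXn2r
    ?nnegrE ?powR_ge0// mulr_ge0 ?enorm_ge0// ltW.
have [th|th] := leP 1 (2 * theta).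
  by exists (kappa ^+ 2); split; [exact: exprn_gt0|exact: loja2].
pose B := L / 2 * mu ^+ 2.
have B0 : 0 < B by rewrite mulr_gt0 ?divr_gt0 ?exprn_gt0.
exists (B `^ (1 - 2 * theta) * kappa ^+ 2); split.
  by rewrite mulr_gt0 ?powR_gt0 ?exprn_gt0.
move=> x xB; rewrite -mulrA.
have -> : `|f x - f xs| `^ 1 =
    `|f x - f xs| `^ (1 - 2 * theta) * `|f x - f xs| `^ (2 * theta).
  by rewrite -powRD ?subrK// oner_eq0.
apply: ler_pM; rewrite ?powR_ge0//; last exact: loja2.
rewrite ge0_ler_powR ?nnegrE ?normr_ge0 ?(ltW B0)//; first lra.
exact: ball_gap_le.
Qed.

End near_critical_point.

Lemma powRD_le (R : realType) (p x y : R) : 0 <= p -> 0 <= x -> 0 <= y ->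
  (x + y) `^ p <= 2 `^ p * (x `^ p + y `^ p).
Proof.
move=> p0; wlog xy : x y / x <= y => [h x0 y0|x0 y0].
  case/orP: (le_total x y) => xy; first exact: h.
  by rewrite addrC [_ `^ p + _]addrC; exact: h.
apply: (@le_trans _ _ ((2 * y) `^ p)).
  rewrite ge0_ler_powR ?nnegrE ?addr_ge0 ?mulr_ge0//; lra.
by rewrite powRM// ler_pM2l ?powR_gt0// lerDr powR_ge0.
Qed.

(** Here a_t is the expected gap, g_t the expected squared projection and D_t
the squared finite-difference radius; b = a + k D with k large enough that the
decrease of k D by a factor 4 pays for the error C D.

For nonnegativity: b is nonincreasing, so from a negative value b_t on the gap
stays below b_t, the inequality |a|^p <= K g keeps g bounded away from 0, and b
would tend to minus infinity, against the lower bound on a. *)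
Lemma lyapunov_recursion (R : realType) (a g D : nat -> R) (p c C K M : R) :
  1 <= p -> 0 < c -> 0 < C -> 0 < K ->
  (forall t, 0 <= g t) ->
  (forall t, 0 <= D t <= 1) -> (forall t, D t.+1 <= D t / 4) ->
  (forall t, - M <= a t) ->
  (forall t, a t.+1 <= a t - c * g t + C * D t) ->
  (forall t, `|a t| `^ p <= K * g t) ->
  exists (b : nat -> R) (c1 c2 : R), [/\ 0 < c1, 0 < c2,
    forall t, 0 <= b t,
    forall t, b t.+1 <= b t - c1 * (g t + D t) &
    forall t, b t.+1 <= b t - c2 * b t `^ p].
Proof.
move=> p1 c0 C0 K0 g0 D01 DS aM aS ag.
have p0 : 0 < p by lra.
have D0 t : 0 <= D t by case/andP: (D01 t).
have D1 t : D t <= 1 by case/andP: (D01 t).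
(* k - k / 4 = C + 1 pays for the error and leaves a decrease of D t *)
pose k := 4 / 3 * (C + 1).
have k0 : 0 < k by rewrite /k; lra.
pose b t := a t + k * D t.
pose c1 := Num.min c 1.
have c10 : 0 < c1 by rewrite lt_min c0 ltr01.
have c1c : c1 <= c by rewrite ge_min lexx.
have c11 : c1 <= 1 by rewrite ge_min lexx orbT.
have kD t : 0 <= k * D t by rewrite mulr_ge0// ltW.
have bS t : b t.+1 <= b t - c1 * (g t + D t).
  have h1 : k * D t.+1 <= k * (D t / 4) by rewrite ler_pM2l.
  have h2 : c1 * g t <= c * g t by apply: ler_wpM2r.
  have h3 : c1 * D t <= 1 * D t by apply: ler_wpM2r.
  have := aS t; rewrite /b; move: h1 h2 h3; rewrite /k; lra.
have bdec t m : b (t + m)%N <= b t.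
  elim: m => [|m IH]; first by rewrite addn0.
  rewrite addnS; apply: le_trans IH; apply: (le_trans (bS _)).
  by rewrite gerBl mulr_ge0 ?addr_ge0// ltW.
have b0 t : 0 <= b t.
  rewrite leNgt; apply/negP => bt.
  pose e := (- b t) `^ p / K.
  have e0 : 0 < e by rewrite divr_gt0 ?powR_gt0// oppr_gt0.
  have ge m : e <= g (t + m)%N.
    rewrite ler_pdivrMr// mulrC; apply: le_trans (ag _).
    rewrite ge0_ler_powR ?nnegrE ?(ltW p0) ?oppr_ge0 ?(ltW bt)//.
    have h : a (t + m)%N <= b t by apply: le_trans (bdec t m); rewrite lerDl.
    rewrite ler0_norm ?lerN2//; exact: le_trans h (ltW bt).
  have lin m : b (t + m)%N <= b t - c1 * e * m%:R.
    elim: m => [|m IH]; first by rewrite addn0 mulr0 subr0.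
    rewrite addnS -natr1; apply: (le_trans (bS _)).
    have : c1 * e <= c1 * (g (t + m)%N + D (t + m)%N).
      by rewrite ler_pM2l// (le_trans (ge m))// lerDl.
    by move: IH; lra.
  pose N := Num.bound `|M / (c1 * e)|.
  have hN : M < c1 * e * N%:R.
    have ce0 : 0 < c1 * e by exact: mulr_gt0.
    rewrite [ltRHS]mulrC -(ltr_pdivrMr _ _ ce0).
    exact: le_lt_trans (ler_norm _) (archi_boundP (normr_ge0 _)).
  have := lin N; have := bt; have := aM (t + N)%N; have := kD (t + N)%N.
  rewrite /b.
  by move: hN; clearbody N; clearbody e; lra.
pose A := 2 `^ p * (K + k `^ p).
have kp : 0 < k `^ p by exact: powR_gt0.
have A0 : 0 < A by rewrite mulr_gt0 ?powR_gt0// addr_gt0.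
exists b, c1, (c1 / A); split => //; first exact: divr_gt0.
move=> t; apply: (le_trans (bS t)); rewrite lerD2l lerN2 -mulrA ler_pM2l//.
rewrite mulrC ler_pdivrMr//.
apply: (@le_trans _ _ ((`|a t| + k * D t) `^ p)).
  rewrite ge0_ler_powR ?nnegrE ?(ltW p0) ?(b0 t) ?addr_ge0//.
  by rewrite /b lerD2r ler_norm.
apply: (le_trans (powRD_le (ltW p0) (normr_ge0 _) (kD t))).
rewrite /A [leRHS]mulrCA ler_pM2l ?powR_gt0//.
have h1 : (k * D t) `^ p <= k `^ p * D t.
  rewrite powRM ?(ltW k0)// ler_pM2l//.
  have [->|Dt] := eqVneq (D t) 0; first by rewrite powR0 ?gt_eqF.
  have Dpos : 0 < D t by rewrite lt_neqAle eq_sym Dt D0.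
  by rewrite -[leRHS]powRr1//; apply: ger_powR => //; rewrite Dpos D1.
have h2 := mulr_ge0 (ltW K0) (D0 t); have h3 := mulr_ge0 (ltW kp) (g0 t).
by have := ag t; lra.
Qed.

(** * Expected tail energy *)

(** Bessel's inequality, one direction at a time. *)
Lemma proj_energy_le (R : realType) (n k : nat) (V : 'M[R]_(n, k))
    (u : 'cV[R]_n) : stiefel V -> proj_energy V u <= k%:R * dot u u.
Proof.
move=> SV; apply: (@le_trans _ _ (\sum_(i < k) dot u u)); last first.
  by rewrite sumr_const card_ord mulr_natl.
apply: ler_sum => i _; set v := col i V.
have v1 : dot v v = 1 by rewrite stiefel_dot// eqxx.
have := dot_ge0 (u - dot u v *: v).
rewrite -scaleNr !(dotDl, dotDr, dotZl, dotZr) v1 (dotC v u); lra.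
Qed.

Lemma measurable_nneseries (R : realType) (d : measure_display)
    (T : measurableType d) (F : nat -> T -> R) t :
  (forall s w, 0 <= F s w) -> (forall s, measurable_fun setT (F s)) ->
  measurable_fun setT (fun w => (\sum_(t <= s <oo) (F s w)%:E)%E).
Proof.
move=> F0 mF; have F0' s w : (0 <= (F s w)%:E)%E by rewrite lee_fin.
under eq_fun => w do rewrite -nneseries_addn//.
apply: (ge0_emeasurable_sum (P := xpredT)) => // s _.
by apply/measurable_EFinP; exact: mF.
Qed.

(** The terms are nonnegative, so the integral of the series is the series of
the integrals, whose partial sums telescope. *)
Lemma integral_nneseries_le (R : realType) (d : measure_display)
    (Omega : measurableType d) (P : probability Omega R)
    (F : nat -> Omega -> R) (b : nat -> R) (C : R) :
  0 <= C -> (forall t, 0 <= b t) -> (forall t w, 0 <= F t w) ->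
  (forall t, P.-integrable setT (EFin \o F t)) ->
  (forall t, \int[P]_w F t w <= C * (b t - b t.+1)) ->
  forall t, (\int[P]_w \sum_(t <= s <oo) (F s w)%:E <= (C * b t)%:E)%E.
Proof.
move=> C0 b0 F0 iF FE t.
have F0' s w : (0 <= (F s w)%:E)%E by rewrite lee_fin.
under eq_integral => w _ do rewrite -nneseries_addn//.
rewrite integral_nneseries//; last first.
  by move=> s; case/integrableP: (iF (s + t)%N).
apply: lime_le.
  by apply: is_cvg_nneseries => s _ _; apply: integral_ge0.
apply: nearW => N.
have FfinE s : (\int[P]_w (F s w)%:E = (\int[P]_w F s w)%:E)%E.
  rewrite /Rintegral fineK//; exact: integrable_fin_num (iF s).
rewrite (eq_bigr (fun s => (\int[P]_w F (s + t)%N w)%:E)); last first.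
  by move=> s _; exact: FfinE.
rewrite sumEFin lee_fin.
apply: (@le_trans _ _ (C * (b t - b (N + t)%N))); last first.
  by apply: ler_wpM2l => //; rewrite gerBl.
elim: N => [|N IH]; first by rewrite big_geq// add0n subrr mulr0.
rewrite big_nat_recr//=; apply: (le_trans (lerD IH (FE _))).
by rewrite -mulrDr addrA subrK addSn.
Qed.

Lemma szgd_delta_bnd (R : realType) (delta0 : R) t : 0 < delta0 <= 1 ->
  0 < szgd_delta delta0 t <= 1.
Proof.
move=> d01; elim: t => [//|t /andP[h1 h2]] /=.
by rewrite divr_gt0//= ler_pdivrMr// mul1r (le_trans h2)// ler1n.
Qed.

(** Everything that the two rates have in common: only the exponent
max(1, 2 theta) of the recursion distinguishes them. *)
Lemma szgd_lyapunov (R : realType) (n k : nat) (k_gt0 : (0 < k)%N)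
    (le_kn : (k <= n)%N)
    (f : 'cV[R]_n -> R) (L theta : R)
    (L_gt0 : 0 < L) (f_smooth : lsmooth L f) (theta_gt0 : 0 < theta)
    (d : measure_display) (Omega : measurableType d) (P : probability Omega R)
    (x0 : 'cV[R]_n) (delta0 : R) (delta0_bnd : 0 < delta0 <= 1)
    (eta : nat -> R)
    (V : nat -> Omega -> 'M[R]_(n, k))
    (V_unif : forall t, uniform_stiefel P (V t))
    (V_indep : mutually_independent P V)
    (x : nat -> Omega -> 'cV[R]_n)
    (x_szgd : forall t w, x t w = szgd f eta delta0 x0 (fun s => V s w) t)
    (x_ball : exists (xs : 'cV[R]_n) (kappa mu : R),
       [/\ critical f xs, 0 < kappa, 0 < mu,
           lojasiewicz_at f theta xs kappa mu &
           {ae P, forall w, forall t, enorm (x t w - xs) <= mu}])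
    (etam etap : R) (etam_gt0 : 0 < etam)
    (etap_lt : etap < 2 * k%:R / (L * n%:R))
    (eta_bnd : forall t, etam <= eta t <= etap) :
  exists (b : nat -> R) (c C : R), [/\ 0 < c /\ 0 < C,
    forall t, 0 <= b t,
    forall t, b t.+1 <= b t - c * b t `^ (Num.max 1 (2 * theta)),
    forall t, measurable_fun setT (fun w => tail_energy (fun s => x s w) t) &
    forall t, (\int[P]_w tail_energy (fun s => x s w) t <= (C * b t)%:E)%E].
Proof.
have n_gt0 : (0 < n)%N by exact: leq_trans le_kn.
have kn0 : 0 < k%:R / n%:R :> R by rewrite divr_gt0 ?ltr0n.
have [xs [kappa [mu [xs_crit k0 mu0 loja ae_ball]]]] := x_ball.
have [cs [Cs [cs0 Cs0 step]]] :=
  szgd_one_step k_gt0 le_kn L_gt0 f_smooth etam_gt0 etap_lt.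
have [K [K0 gapK]] :=
  ball_gap_powR_le L_gt0 f_smooth xs_crit mu0 theta_gt0 k0 loja.
set p := Num.max 1 (2 * theta) in gapK *.
have p1 : 1 <= p by rewrite le_max lexx.
pose dl t := szgd_delta delta0 t.
have dl0 t : 0 < dl t by case/andP: (szgd_delta_bnd t delta0_bnd).
have dl1 t : dl t <= 1 by case/andP: (szgd_delta_bnd t delta0_bnd).
have xS t w : x t.+1 w = x t w - eta t *: zo_grad f (V t w) (dl t) (x t w).
  by rewrite !x_szgd.
(* one event of full probability on which all frames are orthonormal and all
   iterates stay in the ball *)
have good : {ae P, forall w, (forall t, stiefel (V t w)) /\
    forall t, enorm (x t w - xs) <= mu}.
  have SV : {ae P, forall w, forall t, stiefel (V t w)}.
    by apply: ae_foralln => t; case: (V_unif t).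
  by apply: filterS2 SV ae_ball => w.
have V_meas t A : borel_mx A -> measurable (V t @^-1` A).
  by case: (V_unif t) => + _ _; apply.
have mV t : entries_measurable (V t).
  by apply: borel_entries_measurable => A; exact: V_meas.
have cf : continuous f.
  by move=> y; apply: differentiable_continuous; case: f_smooth.
have cgrad (i : 'I_n) : continuous (fun y => grad f y i 0).
  move=> y.
  apply: (@continuous_comp _ _ _ (grad f) (fun M : 'cV[R]_n => M i 0)).
    by case: f_smooth => _ + _; apply.
  exact: coord_continuous.
have xE t : x t = fun w => szgd f eta delta0 x0 (fun s => V s w) t.
  by apply/funext => w; exact: x_szgd.
have mx t : entries_measurable (x t).
  by rewrite xE; apply: szgd_entries_measurable.
have mx_hist t : entries_measurable (x t : history V t -> 'cV[R]_n).
  rewrite xE; apply: (@szgd_entries_measurable _ _ _ _ (history V t)) => // s st.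
  exact: entries_measurable_history.
have mgrad t : entries_measurable (fun w => grad f (x t w)).
  move=> i j; rewrite (ord1 j).
  exact: entries_measurable_continuous (mx t) (cgrad i).
have mgrad_hist t :
    entries_measurable ((fun w => grad f (x t w)) : history V t -> 'cV[R]_n).
  move=> i j; rewrite (ord1 j).
  exact: entries_measurable_continuous (mx_hist t) (cgrad i).
pose gap t w := f (x t w) - f xs.
pose S t w := dot (grad f (x t w)) (grad f (x t w)).
pose G t w := proj_energy (V t w) (grad f (x t w)).
pose En t w := enorm (x t.+1 w - x t w) ^+ 2.
have mgap t : measurable_fun setT (gap t).
  apply: measurable_funB => //.
  exact: entries_measurable_continuous (mx t) cf.
have mS t : measurable_fun setT (S t).
  by apply: measurable_sum => i; apply: measurable_funM; exact: mgrad.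
have mG t : measurable_fun setT (G t).
  apply: measurable_sum => i; apply: measurable_funX.
  apply: measurable_sum => j; apply: measurable_funM; first exact: mgrad.
  by under eq_fun => w do rewrite mxE; exact: mV.
have mEn t : measurable_fun setT (En t).
  rewrite (_ : En t = fun w => \sum_i (x t.+1 w i 0 - x t w i 0) ^+ 2).
    apply: measurable_sum => i; apply: measurable_funX.
    by apply: measurable_funB; exact: mx.
  apply/funext => w; rewrite /En enorm_sqr; apply: eq_bigr => i _.
  by rewrite !mxE -expr2.
have Sbnd t : {ae P, forall w, S t w <= (L * mu) ^+ 2}.
  by apply: filterS good => w [_ /(_ t)]; exact: ball_grad_le.
have gap_bnd t : {ae P, forall w, `|gap t w| <= L / 2 * mu ^+ 2}.
  by apply: filterS good => w [_ /(_ t)]; exact: ball_gap_le.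
have iGap t : P.-integrable setT (EFin \o gap t).
  exact: ae_bounded_integrable (gap_bnd t).
have iS t : P.-integrable setT (EFin \o S t).
  apply: (ae_bounded_integrable (M := (L * mu) ^+ 2) (mS t)).
  apply: filterS (Sbnd t) => w h.
  by rewrite ger0_norm//; exact: dot_ge0.
have iG t : P.-integrable setT (EFin \o G t).
  apply: (@ae_bounded_integrable _ _ _ _ _ (k%:R * (L * mu) ^+ 2)) => //.
  apply: filterS2 good (Sbnd t) => w [SV _] Sw.
  rewrite ger0_norm ?proj_energy_ge0//.
  by apply: (le_trans (proj_energy_le _ (SV t))); rewrite ler_wpM2l.
have step_ae t : {ae P, forall w,
    gap t.+1 w <= gap t w - cs * G t w + Cs * dl t ^+ 2 /\
    En t w <= Cs * (G t w + dl t ^+ 2)}.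
  apply: filterS good => w [SV _].
  have [h1 h2] := step _ (x t w) _ _ (SV t) (eta_bnd t) (dl0 t).
  rewrite /gap /En xS; split => //.
  by move: h1; rewrite /G; lra.
have ic (r : R) : P.-integrable setT (EFin \o (fun=> r)).
  exact: finite_measure_integrable_cst.
have iZ (r : R) X : P.-integrable setT (EFin \o X) ->
    P.-integrable setT (EFin \o (fun w => r * X w)).
  exact: (integrableZl measurableT).
have iD X Y : P.-integrable setT (EFin \o X) ->
    P.-integrable setT (EFin \o Y) ->
    P.-integrable setT (EFin \o (fun w => X w + Y w)).
  exact: (integrableD measurableT).
have iB X Y : P.-integrable setT (EFin \o X) ->
    P.-integrable setT (EFin \o Y) ->
    P.-integrable setT (EFin \o (fun w => X w - Y w)).
  exact: (integrableB measurableT).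
have iEnB t : P.-integrable setT (EFin \o (fun w => Cs * (G t w + dl t ^+ 2))).
  by apply: iZ; apply: iD.
have iEn t : P.-integrable setT (EFin \o En t).
  apply: (ae_bounded_integrable (M := Cs * (k%:R * (L * mu) ^+ 2 + 1))) => //.
  apply: filterS3 good (Sbnd t) (step_ae t) => w [SV _] Sw [_ h].
  rewrite ger0_norm ?sqr_ge0//; apply: (le_trans h); rewrite ler_pM2l//.
  apply: lerD; last by rewrite exprn_ile1// ltW.
  by apply: (le_trans (proj_energy_le _ (SV t))); rewrite ler_wpM2l.
pose a t := \int[P]_w gap t w.
pose g t := \int[P]_w G t w.
have aS t : a t.+1 <= a t - cs * g t + Cs * dl t ^+ 2.
  rewrite /a /g -(RintegralZl _ measurableT (iG t)).
  rewrite -(RintegralB measurableT (iGap t) (iZ cs _ (iG t))).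
  rewrite -(Rintegral_const P (Cs * dl t ^+ 2)).
  rewrite -(RintegralD measurableT (iB _ _ (iGap t) (iZ cs _ (iG t))) (ic _)).
  apply: ae_le_Rintegral => //.
    by apply: iD => //; apply: iB => //; exact: iZ.
  by apply: filterS (step_ae t) => w [].
have EnE t : \int[P]_w En t w <= Cs * (g t + dl t ^+ 2).
  rewrite /g -(Rintegral_const P (dl t ^+ 2)).
  rewrite -(RintegralD measurableT (iG t) (ic _)).
  rewrite -(RintegralZl _ measurableT (iD _ _ (iG t) (ic _))).
  by apply: ae_le_Rintegral => //; apply: filterS (step_ae t) => w [].
have gE t : g t = k%:R / n%:R * \int[P]_w S t w.
  exact: (Rintegral_proj_energy n_gt0 V_unif V_indep (mgrad_hist t) (mgrad t)
    (Sbnd t)).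
have g0 t : 0 <= g t by apply: Rintegral_ge0 => w _; exact: proj_energy_ge0.
have ag t : `|a t| `^ p <= K / (k%:R / n%:R) * g t.
  rewrite gE mulrA divfK ?gt_eqF//.
  rewrite -(RintegralZl _ measurableT (iS t)).
  apply: (@le_trans _ _ ((\int[P]_w `|gap t w|) `^ p)).
    rewrite ge0_ler_powR ?nnegrE ?(le_trans ler01 p1)//.
      by apply: Rintegral_ge0 => w _.
    exact: le_normr_Rintegral.
  apply: jensen_powR => //.
  - exact: integrable_norm (iGap t).
  - exact: iZ.
  - by apply: filterS good => w [_ /(_ t)]; exact: gapK.
have aM t : - (L / 2 * mu ^+ 2) <= a t.
  rewrite -(Rintegral_const P (- _)); apply: ae_le_Rintegral => //.
  by apply: filterS (gap_bnd t) => w; rewrite ler_norml => /andP[].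
have D01 t : 0 <= dl t ^+ 2 <= 1.
  by rewrite sqr_ge0 exprn_ile1// ltW.
have DS t : dl t.+1 ^+ 2 <= dl t ^+ 2 / 4.
  by rewrite /dl /= -/(dl t); lra.
have [b [c1 [c2 [c10 c20 b0 bS bp]]]] :=
  lyapunov_recursion p1 cs0 Cs0 (divr_gt0 K0 kn0) g0 D01 DS aM aS ag.
exists b, c2, (Cs / c1); split => //; first by split; last exact: divr_gt0.
  move=> t; apply: (measurable_nneseries (F := En)) => // s w.
  exact: sqr_ge0.
move=> t; apply: (integral_nneseries_le (F := En)) => //.
- by rewrite divr_ge0// ltW.
- by move=> s w; exact: sqr_ge0.
- move=> s; apply: (le_trans (EnE s)); rewrite -mulrA ler_pM2l//.
  by rewrite mulrC ler_pdivlMr// mulrC; have := bS s; lra.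
Qed.

(** * Convergence rates *)

Theorem theorem4 (R : realType) (n k : nat) (k_gt0 : (0 < k)%N)
    (le_kn : (k <= n)%N)
    (f : 'cV[R]_n -> R) (L theta : R)
    (L_gt0 : 0 < L)
    (f_smooth : lsmooth L f)
    (f_loja : lojasiewicz f theta)
    (f_lb : has_lbound (range f))
    (f_isolated : forall x, critical f x -> isolated (critical f) x)
    (d : measure_display) (Omega : measurableType d) (P : probability Omega R)
    (x0 : 'cV[R]_n) (delta0 : R) (delta0_bnd : 0 < delta0 <= 1)
    (eta : nat -> R) (eta_gt0 : forall t, 0 < eta t)
    (V : nat -> Omega -> 'M[R]_(n, k))
    (V_unif : forall t, uniform_stiefel P (V t))
    (V_indep : mutually_independent P V)
    (x : nat -> Omega -> 'cV[R]_n)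
    (x_szgd : forall t w, x t w = szgd f eta delta0 x0 (fun s => V s w) t)
    (x_ball : exists (xs : 'cV[R]_n) (kappa mu : R),
       [/\ critical f xs, 0 < kappa, 0 < mu,
           lojasiewicz_at f theta xs kappa mu &
           {ae P, forall w, forall t, enorm (x t w - xs) <= mu}])
    (etam etap : R) (etam_gt0 : 0 < etam) (etap_gt0 : 0 < etap)
    (eta_bnd : forall t, etam <= eta t <= etap) :
  (0 < theta <= 1 / 2 ->
   -1 <= L * n%:R * etam ^+ 2 / (2 * k%:R) - etam < 0 ->
   -1 <= L * n%:R * etap ^+ 2 / (2 * k%:R) - etap < 0 ->
   exists Q : R, 1 < Q /\
     ((\int[P]_w ((Q ^+ t)%:E * tail_energy (fun s => x s w) t))%E
        @[t --> \oo] --> 0%E))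
  /\
  (1 / 2 < theta < 1 ->
   0 < etam < 2 * k%:R / (L * n%:R) ->
   0 < etap < 2 * k%:R / (L * n%:R) ->
   exists C : R, \forall t \near \oo,
     (\int[P]_w (tail_energy (fun s => x s w) t)
        <= (C * t%:R `^ (1 / (1 - 2 * theta)))%:E)%E).
Proof.
have k0 : 0 < k%:R :> R by rewrite ltr0n.
have n0 : 0 < n%:R :> R by rewrite ltr0n (leq_trans k_gt0).
have Ln0 : 0 < L * n%:R by rewrite mulr_gt0.
have [/andP[th0 _] _ _] := f_loja.
have decay := szgd_lyapunov k_gt0 le_kn L_gt0 f_smooth th0 delta0_bnd V_unif
  V_indep x_szgd x_ball etam_gt0 _ eta_bnd.
have tail0 t w : (0 <= tail_energy (fun s => x s w) t)%E.
  by apply: nneseries_ge0 => s _ _; rewrite lee_fin sqr_ge0.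
split.
- move=> /andP[_ th] _ /andP[_ etap_neg].
  have etap_lt : etap < 2 * k%:R / (L * n%:R).
    rewrite ltr_pdivlMr// -(ltr_pM2l etap_gt0).
    move: etap_neg; rewrite subr_lt0 ltr_pdivrMr ?mulr_gt0//; lra.
  have [b [c [C [[c0 C0] b0 bS mtail tail]]]] := decay etap_lt.
  have p1 : Num.max 1 (2 * theta) = 1 by apply/max_idPl; lra.
  (* capping c keeps the ratio q positive *)
  pose c' := Num.min c (1 / 2).
  have c'0 : 0 < c' by rewrite lt_min c0 divr_gt0.
  have c'2 : c' <= 1 / 2 by rewrite ge_min lexx orbT.
  have bS' t : b t.+1 <= b t - c' * b t.
    apply: (le_trans (bS t)); rewrite p1 powRr1// lerD2l lerN2.
    by apply: ler_wpM2r => //; rewrite ge_min lexx.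
  have bq := linear_recursion_decay (ltac:(lra) : c' <= 1) bS'.
  pose q := 1 - c'.
  have q0 : 0 < q by rewrite /q; lra.
  (* between 1 and 1 / q, so that Q^t still decays against q^t *)
  pose Q := (1 + q^-1) / 2.
  have Qq : Q * q = 1 - c' / 2 by rewrite /Q /q; field; rewrite gt_eqF.
  have Q1 : 1 < Q.
    by rewrite -(ltr_pM2r q0) Qq mul1r /q; lra.
  have Q0 : 0 <= Q by lra.
  exists Q; split=> //.
  apply: (@squeeze_cvge _ _ _ _ (cst 0%E) _
    (EFin \o geometric (C * b 0%N) (Q * q))).
  + apply: nearW => t; apply/andP; split.
      by apply: integral_ge0 => w _; rewrite mule_ge0// lee_fin exprn_ge0.
    rewrite ge0_integralZl_EFin ?exprn_ge0//.
    apply: (@le_trans _ _ ((Q ^+ t)%:E * (C * b t)%:E)%E).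
      by apply: lee_wpmul2l => //; rewrite lee_fin exprn_ge0.
    rewrite -EFinM lee_fin /geometric /= [(Q * q) ^+ t]exprMn.
    have -> : C * b 0%N * (Q ^+ t * q ^+ t) = Q ^+ t * (C * (q ^+ t * b 0%N)).
      by ring.
    by rewrite ler_wpM2l ?exprn_ge0// ler_pM2l//; exact: bq.
  + exact: cvg_cst.
  + apply: cvg_EFin; first exact: nearW.
    apply: cvg_geometric; rewrite Qq ger0_norm; lra.
- move=> /andP[th1 _] _ /andP[_ etap_lt].
  have [b [c [C [[c0 C0] b0 bS _ tail]]]] := decay etap_lt.
  have p2 : Num.max 1 (2 * theta) = 2 * theta by apply/max_idPr; lra.
  rewrite p2 in bS.
  have p1 : 1 < 2 * theta by lra.
  have bt := superlinear_recursion_decay c0 p1 b0 bS.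
  exists (C * ((2 * theta - 1) * c) `^ (1 / (1 - 2 * theta))).
  exists 1%N => // t t0; apply: (le_trans (tail t)); rewrite lee_fin -mulrA.
  by rewrite ler_pM2l//; exact: bt.
Qed.
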